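(* Let $k$ be a field and let $A=k\{x_1,\ldots,x_d\}/I$ be a prime monomial $k$-algebra of quadratic growth. Then the set of prime ideals $P$ of $A$ such that $\mathrm{GKdim}(A/P)=1$ is finite; moreover, all such primes are monomial ideals. In particular, $A$ has bounded matrix images.
   Context: Algebras are associative and unital; $k\{x_1,\ldots,x_d\}$ is the free algebra. A monomial algebra is an algebra $A\cong k\{x_1,\ldots,x_d\}/I$ where $I$ is an ideal generated by monomials (words) in $x_1,\ldots,x_d$. A monomial ideal of $A$ is an ideal generated by images of words in $x_1,\ldots,x_d$. A frame of a finitely generated $k$-algebra $A$ is a finite-dimensional $k$-subspace $V$ of $A$ with $1\in V$ that generates $A$ as a $k$-algebra. $A$ has quadratic growth if there exist a frame $V$ of $A$ and constants $C_1,C_2>0$ with $C_1n^2\le \dim_k(V^n)\le C_2n^2$ for all $n\ge 1$. The GK dimension is $\mathrm{GKdim}(A)=\limsup_{n\to\infty}\log(\dim_k V^n)/\log n$ for any frame $V$ of $A$. $A$ has bounded matrix images if there is a positive integer $N$ such that every prime homomorphic image of $A$ that is finite-dimensional over $k$ satisfies the standard identity $S_{2N}$ (equivalently, has PI degree at most $N$). *)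

(* Defs.v *)
From HB Require Import structures.
From mathcomp Require Import all_boot all_order perm all_algebra.
From mathcomp Require Import boolp classical_sets functions cardinality.
From mathcomp Require Import reals ereal topology normedtype sequences exp.
(* The notations of monalg are incompatible with those of topology. *)
From mathcomp Require Import -(notations) monalg.

Set Implicit Arguments.
Unset Strict Implicit.
Unset Printing Implicit Defensive.

Import GRing.Theory.

Local Open Scope classical_set_scope.
Local Open Scope ring_scope.

(* The words in x_1, ..., x_d are the elements of fmonom 'I_d, the free
   monoid on 'I_d. *)
Definition freeAlg (k : fieldType) (d : nat) : Type := malg (fmonom 'I_d) k.

Section FreeAlg.
Variables (k : fieldType) (d : nat).

HB.instance Definition _ := GRing.Lalgebra.on (freeAlg k d).

Lemma freeAlg_scalerAr (c : k) (x y : freeAlg k d) :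
  c *: (x * y) = x * (c *: y).
Proof.
apply/malgP => w; rewrite mcoeffZ mcoeffMl.
rewrite (mcoeffMlw w (finmap.fsubset_refl (msupp x)) (msuppZ_le c y)).
rewrite big_distrr; apply: eq_bigr => u _.
rewrite big_distrr; apply: eq_bigr => v _ /=.
by rewrite mcoeffZ mulrnAr mulrCA.
Qed.

HB.instance Definition _ :=
  GRing.Lalgebra_isAlgebra.Build k (freeAlg k d) freeAlg_scalerAr.

Definition word (w : fmonom 'I_d) : freeAlg k d := mkmalgU w 1.

End FreeAlg.

Definition two_sided_ideal (A : nzRingType) (I : set A) : Prop :=
  GRing.zmod_closed [in I] /\
  forall a x, I x -> I (a * x) /\ I (x * a).

Definition ideal_gen (A : nzRingType) (S : set A) : set A :=
  smallest (@two_sided_ideal A) S.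

(* The rings underlying an algType are nonzero, so that quotient algebras are
   formed for proper ideals only. *)
Record properIdeal (A : nzRingType) := ProperIdeal {
  ideal_set :> set A;
  ideal_setP : two_sided_ideal ideal_set;
  ideal_set1 : ~ ideal_set 1
}.

Section Quotient.
Variables (k : fieldType) (A : algType k) (I : properIdeal A).
Local Notation J := (ideal_set I).

Definition ideal_pred : {pred A} := [in J].

Lemma ideal_pred_zmod_closed : zmod_closed ideal_pred.
Proof. by case: (ideal_setP I). Qed.

HB.instance Definition _ :=
  GRing.isZmodClosed.Build A ideal_pred ideal_pred_zmod_closed.

Definition quotAlg : Type := Quotient.quot ideal_pred.

HB.instance Definition _ := GRing.Zmodule.on quotAlg.

Definition proj (x : A) : quotAlg := (\pi_(Quotient.quot ideal_pred) x)%qT.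
Let lift (u : quotAlg) : A := repr (u : Quotient.quot ideal_pred).

Let liftK : cancel lift proj. Proof. exact: reprK. Qed.

Lemma proj_eq x y : proj x = proj y <-> J (x - y).
Proof.
split=> [/eqP|Ixy]; last by apply/eqP; rewrite -Quotient.idealrBE; exact/mem_set.
by rewrite -Quotient.idealrBE => /set_mem.
Qed.

Lemma proj_surj u : exists x, proj x = u.
Proof. by exists (lift u). Qed.

Let idealM a x : J x -> J (a * x) /\ J (x * a).
Proof. by case: (ideal_setP I) => _; apply. Qed.

Let idealD x y : J x -> J y -> J (x + y).
Proof.
move=> /mem_set Ix /mem_set Iy; apply: set_mem.
exact: (rpredD (S := ideal_pred)).
Qed.

Let projD : {morph proj : x y / x + y}.
Proof. exact: (raddfD (\pi_(Quotient.quot ideal_pred))%qT). Qed.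

Let proj_ideal x y : J (x - y) -> proj x = proj y.
Proof. by move/proj_eq. Qed.

Let qone : quotAlg := proj 1.
Let qmul (u v : quotAlg) : quotAlg := proj (lift u * lift v).
Let qscale (c : k) (u : quotAlg) : quotAlg := proj (c *: lift u).

Let projM x y : proj (x * y) = qmul (proj x) (proj y).
Proof.
apply: proj_ideal; have [Ix Iy] : J (x - lift (proj x)) /\ J (y - lift (proj y)).
  by split; apply/proj_eq; rewrite liftK.
rewrite -[_ - _](subrKA (lift (proj x) * y)) -mulrBl -mulrBr.
by apply: idealD; [have [] := idealM y Ix | have [] := idealM (lift (proj x)) Iy].
Qed.

Let projZ c x : proj (c *: x) = qscale c (proj x).
Proof.
apply: proj_ideal; have Ix : J (x - lift (proj x)).
  by apply/proj_eq; rewrite liftK.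
by rewrite -scalerBr -mulr_algl; have [] := idealM c%:A Ix.
Qed.

Let qmulA : associative qmul.
Proof.
by move=> u v w; rewrite -[u]liftK -[v]liftK -[w]liftK -!projM mulrA.
Qed.

Let qmul1 : left_id qone qmul.
Proof. by move=> u; rewrite -[u]liftK -projM mul1r. Qed.

Let qmulr1 : right_id qone qmul.
Proof. by move=> u; rewrite -[u]liftK -projM mulr1. Qed.

Let qmulDl : left_distributive qmul +%R.
Proof.
by move=> u v w; rewrite -[u]liftK -[v]liftK -[w]liftK -projD -!projM mulrDl projD.
Qed.

Let qmulDr : right_distributive qmul +%R.
Proof.
by move=> u v w; rewrite -[u]liftK -[v]liftK -[w]liftK -projD -!projM mulrDr projD.
Qed.

Let proj0 : proj 0 = 0.
Proof. exact: (raddf0 (\pi_(Quotient.quot ideal_pred))%qT). Qed.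

Let qone_neq0 : qone != 0.
Proof.
apply/eqP; rewrite -proj0 => /proj_eq; rewrite subr0; exact: ideal_set1.
Qed.

HB.instance Definition _ := GRing.Zmodule_isNzRing.Build quotAlg
  qmulA qmul1 qmulr1 qmulDl qmulDr qone_neq0.

Let qscaleA a b (u : quotAlg) : qscale a (qscale b u) = qscale (a * b) u.
Proof. by rewrite -[u]liftK -!projZ scalerA. Qed.

Let qscale1 : left_id 1 qscale.
Proof. by move=> u; rewrite -[u]liftK -projZ scale1r. Qed.

Let qscaleDr : right_distributive qscale +%R.
Proof.
by move=> a u v; rewrite -[u]liftK -[v]liftK -projD -!projZ scalerDr projD.
Qed.

Let qscaleDl (u : quotAlg) : {morph qscale^~ u : a b / a + b}.
Proof. by move=> a b; rewrite -[u]liftK -!projZ scalerDl projD. Qed.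

HB.instance Definition _ := GRing.Zmodule_isLmodule.Build k quotAlg
  qscaleA qscale1 qscaleDr qscaleDl.

Let qscaleAl (a : k) (u v : quotAlg) : a *: (u * v) = (a *: u) * v.
Proof.
rewrite -[u]liftK -[v]liftK; change (qscale a (qmul (proj (lift u)) (proj (lift v)))
  = qmul (qscale a (proj (lift u))) (proj (lift v))).
by rewrite -projM -!projZ -projM scalerAl.
Qed.

HB.instance Definition _ :=
  GRing.Lmodule_isLalgebra.Build k quotAlg qscaleAl.

Let qscaleAr (a : k) (u v : quotAlg) : a *: (u * v) = u * (a *: v).
Proof.
rewrite -[u]liftK -[v]liftK; change (qscale a (qmul (proj (lift u)) (proj (lift v)))
  = qmul (proj (lift u)) (qscale a (proj (lift v)))).
by rewrite -projM -!projZ -projM scalerAr.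
Qed.

HB.instance Definition _ :=
  GRing.Lalgebra_isAlgebra.Build k quotAlg qscaleAr.

Let proj_is_zmod_morphism : zmod_morphism proj.
Proof. exact: (raddfB (\pi_(Quotient.quot ideal_pred))%qT). Qed.

HB.instance Definition _ :=
  GRing.isZmodMorphism.Build A quotAlg proj proj_is_zmod_morphism.

Let proj_is_monoid_morphism : monoid_morphism proj.
Proof. by split=> // x y; exact: projM. Qed.

HB.instance Definition _ :=
  GRing.isMonoidMorphism.Build A quotAlg proj proj_is_monoid_morphism.

Let proj_is_scalable : scalable proj.
Proof. by move=> c x; exact: projZ. Qed.

HB.instance Definition _ :=
  GRing.isScalable.Build k A quotAlg *:%R proj proj_is_scalable.

End Quotient.

Arguments proj {k A} I x.

Definition prime_ideal (A : nzRingType) (P : set A) : Prop :=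
  [/\ two_sided_ideal P, ~ P 1 &
      forall J K : set A, two_sided_ideal J -> two_sided_ideal K ->
        (forall a b, J a -> K b -> P (a * b)) -> J `<=` P \/ K `<=` P].

Definition prime_algebra (A : nzRingType) : Prop :=
  prime_ideal [set (0 : A)].

Section Dimension.
Variables (k : fieldType) (V : lmodType k).

Definition lspan (S : set V) : set V :=
  smallest (fun U : set V => GRing.submod_closed [in U]) S.

Definition lin_indep (m : nat) (b : 'I_m -> V) : Prop :=
  forall c : 'I_m -> k, \sum_(i < m) c i *: b i = 0 -> forall i, c i = 0.

Definition has_dim (U : set V) (m : nat) : Prop :=
  exists b : 'I_m -> V, lin_indep b /\ lspan (range b) = U.

Definition finite_dim (U : set V) : Prop := exists m, has_dim U m.

(* Takes the junk value 0 on infinite-dimensional subspaces. *)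
Definition subspace_dim (U : set V) : nat := xget 0%N [set m | has_dim U m].

End Dimension.

Section Growth.
Variables (k : fieldType) (A : algType k).

Definition generates (V : set A) : Prop :=
  smallest (fun B : set A => GRing.subalg_closed [in B]) V = setT.

Definition frame (V : set A) : Prop :=
  [/\ GRing.submod_closed [in V], finite_dim V, V 1 & generates V].

Fixpoint subspace_pow (V : set A) (n : nat) : set A :=
  if n is m.+1 then lspan [set u * v | u in V & v in subspace_pow V m]
  else lspan [set 1].

Definition quadratic_growth (R : realType) : Prop :=
  exists V : set A, frame V /\
  exists C1 C2 : R, [/\ 0 < C1, 0 < C2 &
    forall n : nat, (1 <= n)%N ->
      C1 * n%:R ^+ 2 <= (subspace_dim (subspace_pow V n))%:R <= C2 * n%:R ^+ 2].

Definition growth_exponent (R : realType) (V : set A) : \bar R :=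
  limn_esup (fun n : nat =>
    (ln (subspace_dim (subspace_pow V n))%:R / ln n%:R : R)%:E).

(* The growth exponent does not depend on the frame; GK dimension is stated
   as a relation, holding only for finitely generated algebras, i.e. for those
   having a frame. *)
Definition has_GKdim (R : realType) (g : \bar R) : Prop :=
  (exists V : set A, frame V) /\
  forall V : set A, frame V -> growth_exponent R V = g.

End Growth.

Arguments quadratic_growth {k} A R.
Arguments has_GKdim {k} A {R} g.

Section Monomial.
Variables (k : fieldType) (d : nat).

Definition monomial_ideal (I : set (freeAlg k d)) : Prop :=
  exists W : set (fmonom 'I_d), I = ideal_gen [set word k w | w in W].

Definition quot_monomial_ideal (I : properIdeal (freeAlg k d))
    (P : set (quotAlg I)) : Prop :=
  exists W : set (fmonom 'I_d), P = ideal_gen [set proj I (word k w) | w in W].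

End Monomial.

Definition satisfies_standard_identity (B : nzRingType) (m : nat) : Prop :=
  forall a : 'I_m -> B,
    \sum_(s : 'S_m) (-1) ^+ s * \prod_(i < m) a (s i) = 0.

Definition bounded_matrix_images (k : fieldType) (A : algType k) : Prop :=
  exists N : nat, (0 < N)%N /\
  forall (B : algType k) (f : {lrmorphism A -> B}),
    range f = setT -> prime_algebra B -> finite_dim [set: B] ->
    satisfies_standard_identity B (2 * N).

(* Main.v *)
Require Import Defs.
From HB Require Import structures.
From mathcomp Require Import all_boot all_order fingroup perm all_algebra.
From mathcomp Require Import finmap zify lra.
From mathcomp Require Import boolp classical_sets functions cardinality.
From mathcomp Require Import reals ereal topology normedtype sequences exp.
From mathcomp Require Import -(notations) monalg.

(** Let A be the monomial algebra and B a prime image of A. The proof reads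
    everything off the language L of the words that are nonzero in B. As B is
    prime, L is recurrent: any two of its words u, v occur in a word u y v of L.
    As L lies in the language of A, whose words are linearly independent in A,
    quadratic growth of A leaves at most C n ^ 2 words of length at most n in L
    ([monomial_quadratic_words]).

    The main point is that L is the set of factors of a periodic sequence, or
    only contains the empty word, as soon as B is finite-dimensional or of GK
    dimension 1. It is enough to find one good word u, such that left
    multiplication by a word u y is zero or injective on the right ideal u B,
    for all y. The words leading from u back to u then form a semigroup of nonzero words. Two
    elements s, t of it commute, for otherwise the products of the factors s t
    and t s, which are different words of the same length, would be
    exponentially many nonzero words. So all of them are powers of one word,
    and by recurrence L is the language of that period
    ([good_word_periodic]).

    If there were no good word, each u B would map onto another right ideal
    u' B with a nonzero kernel, and iterating this would put the growth of
    arbitrarily many nonzero right ideals into B ([no_good_word_growth]). This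
    is impossible if B is finite-dimensional. Otherwise a nonzero right ideal
    of the prime algebra B grows at least linearly ([right_ideal_rank]), while
    B itself grows at most linearly when its GK dimension is 1. The last claim
    is Bergman's gap theorem, proved on the normal words of B, which form a
    factorial language with the growth of B ([linear_growth]).

    The three conclusions follow. If L is periodic, a linear relation between
    words of L makes B finite-dimensional ([periodic_relation]); so a prime P
    with GKdim (A / P) = 1 is generated by the words it contains, and is
    determined by L. A recurrent language with at most C n ^ 2 words of length
    at most n has finitely many periodic sublanguages, since each of them gives
    rise to linearly many words of a given length that follow it up to some
    place and then leave it ([card_periodic_sublanguages]). Lastly, an algebra
    with a periodic language of period p is a quotient of a subalgebra of the
    p by p matrices over k[X] and satisfies the standard identities of degree
    more than p ^ 2 ([periodic_standard_identity]); finitely many periods are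
    bounded by a common one. *)

Set Implicit Arguments.
Unset Strict Implicit.
Unset Printing Implicit Defensive.

(** * Languages with few words *)

Section Languages.
Variable X : finType.
Implicit Types (L N : set (seq X)) (u v w : seq X).

Definition factorial L := forall a w b, L (a ++ w ++ b) -> L w.

Definition count_words L n := #|[set t : n.-tuple X | `[< L t >]]|.

Definition left_extendable L w := forall K, exists2 b, size b = K & L (b ++ w).

Lemma left_extendable_cons L w : factorial L ->
  left_extendable L w -> exists x, left_extendable L (x :: w).
Proof.
move=> facL extw; apply: contrapT => noext.
have /choice [K KP] : forall x, exists K, forall b, size b = K -> ~ L (b ++ x :: w).
  move=> x; apply: contrapT => h; apply: noext; exists x => K.
  by apply: contrapT => h'; apply: h; exists K => b sb Lb; apply: h'; exists b.
have [b] := extw (\max_x K x).+1.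
elim/last_ind: b => [//|b x _]; rewrite size_rcons cat_rcons => -[sb] Lb.
have leK : K x <= size b by rewrite sb leq_bigmax.
apply: (KP x (drop (size b - K x) b)); first by rewrite size_drop subKn.
apply: (facL (take (size b - K x) b) _ [::]).
by rewrite cats0 catA cat_take_drop.
Qed.

Lemma left_extendable_factorial L : factorial L -> factorial (left_extendable L).
Proof.
move=> facL a w b ext K; have [c sc Lc] := ext K.
exists (drop (size a) (c ++ a)); first by rewrite size_drop size_cat sc addnK.
apply: (facL (take (size a) (c ++ a)) _ b).
by rewrite -catA catA cat_take_drop -catA.
Qed.

(** A word that is not left-extendable has a bound on its extensions; the
    largest bound over the finitely many words of length m serves them all. *)
Lemma left_extendable_uniform L m : exists K, forall w b,
  factorial L -> size w = m -> size b = K -> L (b ++ w) -> left_extendable L w.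
Proof.
have /choice [K KP] : forall t : m.-tuple X, exists K,
    (exists2 b, size b = K & L (b ++ t)) -> left_extendable L t.
  move=> t; have [ext|/existsNP[K h]] := pselect (left_extendable L t).
    by exists 0.
  by exists K => /h.
exists (\max_t K t) => w b facL sw sb Lb.
have := KP (tcast sw (in_tuple w)); rewrite val_tcast /=; apply.
have leK : K (tcast sw (in_tuple w)) <= size b by rewrite sb leq_bigmax.
exists (drop (size b - K (tcast sw (in_tuple w))) b).
  by rewrite size_drop subKn.
apply: (facL (take (size b - K (tcast sw (in_tuple w))) b) _ [::]).
by rewrite cats0 catA cat_take_drop.
Qed.

Lemma count_wordsS L L' n : (L `<=` L')%classic -> count_words L n <= count_words L' n.
Proof.
move=> sub; apply/subset_leq_card/fintype.subsetP => t.
by rewrite !finset.in_set => /asboolP Lt; apply/asboolP; exact: sub.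
Qed.

(** Morse--Hedlund: deleting the first letter maps the words of length m + 1
    onto those of length m, so it is injective when there are no more of the
    former than of the latter. *)
Lemma extendable_deterministic L m :
  (forall w, L w -> exists x, L (x :: w)) ->
  count_words L m.+1 <= count_words L m ->
  forall x y w, size w = m -> L (x :: w) -> L (y :: w) -> x = y.
Proof.
move=> extL le x y w sw Lx Ly.
pose E n := [set t : n.-tuple X | `[< L t >]].
pose f (t : m.+1.-tuple X) : m.-tuple X := behead_tuple t.
have sub : E m \subset f @: E m.+1.
  apply/fintype.subsetP => t; rewrite finset.in_set => /asboolP /extL [z Lz].
  apply/imsetP; exists (cons_tuple z t); first by rewrite finset.in_set; apply/asboolP.
  exact/val_inj.
have card : #|f @: E m.+1| == #|E m.+1|.
  rewrite eqn_leq leq_imset_card; exact: leq_trans le (subset_leq_card sub).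
have /imset_injP injf := card.
have sx z : size (z :: w) == m.+1 by rewrite /= sw.
have /(congr1 (fun t => head x (tval t))) //= :
    Tuple (sx x) = Tuple (sx y).
apply: injf; rewrite ?finset.in_set; try exact/asboolP.
exact/val_inj.
Qed.

(** Bergman's gap, for languages. The left-extendable words form a sublanguage
    whose size cannot increase at all the lengths up to n, so that beyond some
    length m such words are determined from right to left by their last m
    letters. In an arbitrary word only the first K letters, for a uniform K,
    escape this, so a word is determined by its first K and last m letters. *)
Lemma count_words_bounded L n : factorial L -> count_words L n <= n ->
  exists D, forall j, count_words L j <= D.
Proof.
move=> facL len; pose E := left_extendable L.
have facE : factorial E by exact: left_extendable_factorial.
have extE w : E w -> exists x, E (x :: w) by exact: left_extendable_cons.
have [m det] : exists m, forall x y w, size w = m -> E (x :: w) -> E (y :: w) -> x = y.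
  have [E0|nE0] := pselect (E [::]); last first.
    exists 0 => x y w _ Ex; case: nE0; apply: (facE [::] _ (x :: w)); exact: Ex.
  have [/existsP [m le]|/existsPn h] :=
    boolP [exists m : 'I_n, count_words E m.+1 <= count_words E m].
    by exists m; exact: extendable_deterministic.
  have cnt j : j <= n -> j < count_words E j.
    elim: j => [_|j IHj ltj].
      rewrite /count_words card_gt0; apply/finset.set0Pn; exists [tuple].
      by rewrite finset.in_set; exact/asboolP.
    apply: leq_ltn_trans (IHj (ltnW ltj)) _.
    by rewrite ltnNge; exact: (h (Ordinal ltj)).
  have EL : (E `<=` L)%classic by move=> w /(_ 0) [[|//]].
  have := cnt n (leqnn _).
  by rewrite ltnNge (leq_trans (count_wordsS _ EL) len).
have [K KP] := left_extendable_uniform L m.+1.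
(* v and v' are what remains of two long words without their first K letters *)
have detw v v' : size v = size v' -> m <= size v ->
    (forall a w b, v = a ++ w ++ b -> size w = m.+1 -> E w) ->
    (forall a w b, v' = a ++ w ++ b -> size w = m.+1 -> E w) ->
    drop (size v - m) v = drop (size v - m) v' -> v = v'.
  elim: v v' => [|x v IH] [|y v'] //= [svv'] le Ev Ev'.
  have [{}le|lt] := leqP m (size v); last first.
    have -> : (size v).+1 - m = 0 by lia.
    by rewrite !drop0.
  rewrite subSn //= => eqd.
  have vv' : v = v'.
    apply: IH => // a w b e; first by apply: (Ev (x :: a) w b); rewrite e.
    by apply: (Ev' (y :: a) w b); rewrite e.
  rewrite -vv' in Ev' *; congr (_ :: _).
  apply: (det _ _ (take m v)); first by rewrite size_takel.
    apply: (Ev [::] _ (drop m v)); first by rewrite /= cat_take_drop.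
    by rewrite /= size_takel.
  apply: (Ev' [::] _ (drop m v)); first by rewrite /= cat_take_drop.
  by rewrite /= size_takel.
exists (\max_(j < K + m) count_words L j + #|{: K.-bseq X * m.-bseq X}|) => j.
have [ltj|lej] := ltnP j (K + m).
  apply: leq_trans (leq_addr _ _).
  exact: (leq_bigmax (F := fun j : 'I_(K + m) => count_words L j) (Ordinal ltj)).
apply: leq_trans (leq_addl _ _).
pose f (t : j.-tuple X) :=
  (insub_bseq K (take K t), insub_bseq m (drop (j - m) t)).
rewrite /count_words.
have/card_in_imset <- : {in [set t : j.-tuple X | `[< L t >]] &, injective f}.
  move=> t t'; rewrite !finset.in_set => /asboolP Lt /asboolP Lt' [].
  have st := size_tuple t; have st' := size_tuple t'.
  move=> /(congr1 val) /= + /(congr1 val) /=; rewrite !val_insubd.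
  rewrite !size_takel ?st ?st' ?size_drop ?st ?st' ?leqnn; try lia.
  rewrite subKn ?leqnn; last by lia.
  move=> eqt eqd; apply/val_inj => /=.
  rewrite -[tval t](cat_take_drop K) -[tval t'](cat_take_drop K) eqt; congr cat.
  have Ef (s : j.-tuple X) : L s -> forall a w b,
      drop K s = a ++ w ++ b -> size w = m.+1 -> E w.
    move=> Ls a w b e sw; have ss := size_tuple s.
    have e' : tval s = (take K s ++ a) ++ w ++ b.
      by rewrite -catA -e cat_take_drop.
    have sa : K <= size (take K s ++ a).
      by rewrite size_cat size_takel ?ss ?leq_addr //; lia.
    apply: (KP w (drop (size (take K s ++ a) - K) (take K s ++ a))) => //.
      by rewrite size_drop subKn.
    apply: (facL (take (size (take K s ++ a) - K) (take K s ++ a)) _ b).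
    by rewrite -catA catA cat_take_drop -e'.
  apply: detw; rewrite ?size_drop ?st ?st' //; first lia.
    exact: Ef.
    exact: Ef.
  rewrite !drop_drop; have -> : j - K - m + K = j - m by lia.
  exact: eqd.
exact: max_card.
Qed.
End Languages.

(** * Periodic languages *)

Section PeriodicLanguages.
Variable X : finType.
Implicit Types (L N T : set (seq X)) (u v w : seq X) (f g : nat -> X).

Definition factors f : set (seq X) :=
  [set w | exists i, w = map f (iota i (size w))]%classic.

Definition periodic p f := 0 < p /\ forall i, f (i + p) = f i.

(** The condition that primeness of an algebra puts on its nonzero words. *)
Definition prime_language L :=
  factorial L /\ forall u v, L u -> L v -> exists x, L (u ++ x ++ v).

Definition quadratic_words L C := forall n s, 0 < n -> uniq s ->
  (forall w, w \in s -> L w /\ size w <= n) -> size s <= C * n ^ 2.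

Lemma factors_window f i n : factors f (map f (iota i n)).
Proof. by exists i; rewrite size_map size_iota. Qed.

Lemma factors_factorial f : factorial (factors f).
Proof.
move=> a w b [i]; rewrite !size_cat !iotaD !map_cat.
move/eqP; rewrite eqseq_cat ?size_map ?size_iota // => /andP[_].
rewrite eqseq_cat ?size_map ?size_iota // => /andP[/eqP -> _].
exact: factors_window.
Qed.

Lemma periodicM p f k : periodic p f -> forall i, f (i + k * p) = f i.
Proof.
move=> [_ per] i; elim: k => [|k IH]; first by rewrite addn0.
by rewrite mulSn addnCA addnC per.
Qed.

Lemma factors_nth f w : factors f w ->
  exists i, forall x0 k, k < size w -> nth x0 w k = f (i + k).
Proof.
move=> [i e]; exists i => x0 k ltk.
by rewrite e (nth_map 0) ?size_iota // nth_iota.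
Qed.

Lemma eq_window f g i j n : (forall k, k < n -> f (i + k) = g (j + k)) ->
  map f (iota i n) = map g (iota j n).
Proof.
move=> h; rewrite -[i]addn0 -[j]addn0 !iotaDl -!map_comp; apply/eq_in_map => k /=.
by rewrite mem_iota => /andP[_]; exact: h.
Qed.

(** Both sequences have period p * q, so a common word of that length makes
    each of them a shift of the other. *)
Lemma factors_eq p q f g w : periodic p f -> periodic q g ->
  factors f w -> factors g w -> p * q <= size w -> factors f = factors g.
Proof.
wlog suff sub : p q f g / periodic p f -> periodic q g ->
    factors f w -> factors g w -> p * q <= size w -> (factors f `<=` factors g)%classic.
  move=> pf qg fw gw le; rewrite eqEsubset; split; first exact: (sub p q).
  by apply: (sub q p) => //; rewrite mulnC.
move=> pf qg /factors_nth[i fi] /factors_nth[j gj] le v [a ->].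
have p0 : 0 < p by case: pf.
have q0 : 0 < q by case: qg.
have x0 : X := f 0.
have eqfg k : f (i + k) = g (j + k).
  have ltk : k %% (p * q) < size w.
    by apply: leq_trans le; rewrite ltn_mod muln_gt0 p0.
  have ek : k = k %% (p * q) + k %/ (p * q) * p * q by rewrite addnC -mulnA -divn_eq.
  rewrite [in RHS]ek addnA (periodicM _ qg) -(gj x0) // (fi x0) //.
  by rewrite [in LHS]ek mulnAC addnA (periodicM _ pf).
have -> : map f (iota a (size v)) = map g (iota (j + (a + i * p - i)) (size v)).
  apply: eq_window => k _; rewrite -addnA -eqfg.
  rewrite -(periodicM i pf (a + k)); congr f.
  by have := leq_pmulr i p0; lia.
exact: factors_window.
Qed.

(** In a factor of f of length at least p, the next letter is the one p places
    back, whatever precedes it. *)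
Lemma factors_next p f c a e : periodic p f -> p <= size a ->
  factors f (rcons a e) -> factors f (c ++ a) -> factors f (rcons (c ++ a) e).
Proof.
move=> [p0 per] le /factors_nth[i fi] fca; have [j fj] := factors_nth fca.
exists j; rewrite size_rcons -addn1 iotaD map_cat /= cats1; congr rcons.
  apply: (@eq_from_nth _ e) => [|k ltk]; first by rewrite size_map size_iota.
  by rewrite (nth_map 0) ?size_iota // nth_iota // fj.
have := fi e (size a); rewrite size_rcons ltnS leqnn nth_rcons ltnn eqxx.
move=> /(_ isT) ->.
have := fi e (size a - p); rewrite size_rcons nth_rcons.
have -> : size a - p < size a by lia.
move=> /(_ ltac:(lia)) h1.
have := fj e (size c + (size a - p)); rewrite size_cat nth_cat.
have -> : (size c + (size a - p) < size c) = false by lia.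
rewrite addKn h1 => /(_ ltac:(lia)) h2.
have -> : i + size a = i + (size a - p) + p by lia.
have -> : j + (size c + size a) = j + (size c + (size a - p)) + p by lia.
by rewrite !per.
Qed.

Lemma prime_extend L u v : prime_language L -> L u -> L v ->
  exists2 b, size v <= size b & L (u ++ b).
Proof.
by move=> [_ pr] Lu Lv; have [x Lx] := pr u v Lu Lv; exists (x ++ v);
  rewrite // size_cat leq_addl.
Qed.

(** If L has a word outside factors f, recurrence lets a word of L follow the
    periodic sequence for any prescribed length and leave it right after. *)
Lemma leaving_word L f p j m : prime_language L -> periodic p f ->
  (factors f `<=` L)%classic -> ~ (L `<=` factors f)%classic ->
  p <= j < m -> exists v, [/\ size v = m, L v, factors f (take j v) &
    ~ factors f (take j.+1 v)].
Proof.
move=> prL pf fL nLf /andP[lepj ltjm]; have [facL pr] := prL.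
have [c Lc nfc] : exists2 c, L c & ~ factors f c.
  apply: contrapT => h; apply: nLf => c Lc; apply: contrapT => nfc.
  by apply: h; exists c.
pose a := map f (iota 0 j).
have sa : size a = j by rewrite size_map size_iota.
have [y Lacy] := pr a c (fL _ (factors_window f 0 j)) Lc.
have [b leb Lb] := prime_extend prL Lacy (fL _ (factors_window f 0 m)).
rewrite size_map size_iota in leb.
set W := a ++ y ++ c in Lacy Lb.
have exr : exists r, `[< ~ factors f (take r (W ++ b)) >].
  exists (size W); apply/asboolP; rewrite take_size_cat // => fW; apply: nfc.
  by apply: (@factors_factorial f (a ++ y) c [::]); rewrite cats0 -catA.
(* r is the length of the shortest prefix that is not a factor of f *)
case: (ex_minnP exr) => r /asboolP nfr minr.
have leW : r <= size W.
  apply: minr; apply/asboolP; rewrite take_size_cat // => fW; apply: nfc.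
  by apply: (@factors_factorial f (a ++ y) c [::]); rewrite cats0 -catA.
have ltjr : j < r.
  rewrite ltnNge; apply/negP => lerj; apply: nfr.
  rewrite /W -catA takel_cat ?sa //.
  apply: (@factors_factorial f [::] _ (drop r a)).
  by rewrite cat_take_drop; exact: factors_window.
case: r nfr minr leW ltjr {exr} => // r nfr minr ltW lejr.
have fr : factors f (take r (W ++ b)).
  apply: contrapT => h; have := minr r; rewrite ltnn => h'.
  by have := h' (asboolT h).
have sWb : size W + m <= size (W ++ b) by rewrite size_cat leq_add2l.
exists (take m (drop (r - j) (W ++ b))); split.
- by rewrite size_takel // size_drop; lia.
- apply: (facL (take (r - j) (W ++ b)) _ (drop m (drop (r - j) (W ++ b)))).
  by rewrite !cat_take_drop.
- rewrite take_takel ?(ltnW ltjm) // take_drop subnKC //.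
  apply: (@factors_factorial f (take (r - j) (take r (W ++ b))) _ [::]).
  by rewrite cats0 cat_take_drop.
- rewrite take_takel // take_drop addSn subnKC // => fn; apply: nfr.
  have sr : r < size (W ++ b) by lia.
  have x0 : X := f 0.
  have e : take r.+1 (W ++ b) = rcons (take r (W ++ b)) (nth x0 (W ++ b) r).
    by rewrite (take_nth x0).
  rewrite e -[take r (W ++ b)](cat_take_drop (r - j)).
  apply: (factors_next pf); first by rewrite size_drop size_takel; lia.
    move: fn; rewrite e drop_rcons // size_takel; lia.
  by rewrite cat_take_drop.
Qed.

(** If there are at least two periodic sublanguages, none of them is L. Each
    then contributes to every large length a number of words proportional to
    the length, one for each place at which the word leaves the sublanguage; so
    the number of words of length at most n is at least a constant times t n ^ 2. The
    factor 9 comes from counting words of length at most 3 N for a single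
    large N. *)
Lemma card_periodic_sublanguages L C t (Z : 'I_t -> set (seq X)) :
  prime_language L -> quadratic_words L C -> injective Z ->
  (forall i, (Z i `<=` L)%classic) ->
  (forall i, exists p f, periodic p f /\ Z i = factors f) -> t <= (9 * C).+1.
Proof.
move=> prL qL injZ ZL perZ.
have [|lt1t] := leqP t 1; first by move=> h; apply: leq_trans h _.
apply: leqW.
have /choice[pf pfP] : forall i, exists pf : nat * (nat -> X),
    periodic pf.1 pf.2 /\ Z i = factors pf.2.
  by move=> i; have [p [f h]] := perZ i; exists (p, f).
pose p i := (pf i).1; pose f i := (pf i).2.
have per i : periodic (p i) (f i) by case: (pfP i).
have ZE i : Z i = factors (f i) by case: (pfP i).
(* a word of length N is a factor of f i for at most one i *)
pose N := \max_i \max_j p i * p j.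
have leN i j : p i * p j <= N.
  by apply: leq_trans (leq_bigmax i); exact: (leq_bigmax (F := fun j => p i * p j)).
have p0 i : 0 < p i by case: (per i).
have lepN i : p i <= N by apply: leq_trans (leN i i); rewrite leq_pmulr.
have N0 : 0 < N by apply: leq_trans (p0 (Ordinal lt1t)) (lepN _).
have sep i i' w : factors (f i) w -> factors (f i') w -> N <= size w -> i = i'.
  move=> fw fw' le; apply: injZ; rewrite !ZE.
  by apply: (factors_eq (per i) (per i') fw fw'); apply: leq_trans le.
have nLZ i : ~ (L `<=` factors (f i))%classic.
  have [i' nei] : exists i', i' != i.
    have [->|h] := eqVneq i (Ordinal lt1t); last by exists (Ordinal lt1t); rewrite eq_sym.
    by exists (Ordinal (ltnW lt1t)).
  move=> sub; case/eqP: nei; apply: (@sep _ _ (map (f i') (iota 0 N))).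
  - exact: factors_window.
  - by apply/sub/(ZL i'); rewrite ZE; exact: factors_window.
  - by rewrite size_map size_iota.
(* the third index is a length, the second the place where Z i is left *)
have /choice[v vP] : forall x : 'I_t * 'I_N * 'I_N, exists v,
    [/\ size v = N + N + x.2, L v, factors (f x.1.1) (take (N + x.1.2) v) &
      ~ factors (f x.1.1) (take (N + x.1.2).+1 v)].
  move=> [[i j] l]; apply: (leaving_word prL (per i)) => //.
    by rewrite -ZE.
  by have := lepN i; have := ltn_ord j; rewrite /=; lia.
have injv : injective v.
  move=> [[i j] l] [[i' j'] l'] e.
  have [/= s1 _ f1 g1] := vP (i, j, l); have [/= s2 _ f2 g2] := vP (i', j', l').
  have ll : l = l' by apply: val_inj => /=; rewrite -e s1 in s2; lia.
  rewrite -e in s2 f2 g2.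
  have tk i0 n n' : n <= n' -> factors (f i0) (take n' (v (i, j, l))) ->
      factors (f i0) (take n (v (i, j, l))).
    move=> le h; rewrite -(take_takel _ le).
    apply: (@factors_factorial _ [::] _ (drop n (take n' (v (i, j, l))))).
    by rewrite cat_take_drop.
  have ii : i = i'.
    apply: (@sep _ _ (take N (v (i, j, l)))).
    - by apply: tk f1; rewrite leq_addr.
    - by apply: tk f2; rewrite leq_addr.
    - by rewrite size_takel // s1; lia.
  rewrite -ll -ii in f2 g2 *; congr (_, _, _); apply: val_inj => /=.
  have [lt|lt|//] := ltngtP (j : nat) j'.
    by case: g1; apply: tk f2; lia.
  by case: g2; apply: tk f1; lia.
have := qL (N + N + N) (map v (enum {: 'I_t * 'I_N * 'I_N})) ltac:(lia).
rewrite map_inj_uniq // enum_uniq => /(_ isT).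
have h w : w \in map v (enum {: 'I_t * 'I_N * 'I_N}) -> L w /\ size w <= N + N + N.
  move=> /mapP[x _ ->]; have [-> Lv _ _] := vP x; split=> //.
  by rewrite leq_add2l ltnW.
move=> /(_ h); rewrite size_map -cardE !card_prod !card_ord.
have -> : C * (N + N + N) ^ 2 = 9 * C * N ^ 2 by lia.
by rewrite -mulnA mulnn leq_pmul2r // expn_gt0 N0.
Qed.

Lemma exp2_gt_square D : exists2 n, 0 < n & D * n ^ 2 < 2 ^ n.
Proof.
exists (4 * (16 * D).+1) => //.
set m := (16 * D).+1.
have h : m ^ 4 < 2 ^ (4 * m) by rewrite mulnC expnM ltn_exp2r // ltn_expl.
apply: leq_ltn_trans h.
have -> : D * (4 * m) ^ 2 = (16 * D) * m ^ 2 by lia.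
have -> : m ^ 4 = m * m * m ^ 2 by lia.
rewrite leq_mul2r; apply/orP; right; apply: leq_trans (leqnSn _) _.
by rewrite -/m leq_pmulr.
Qed.

(** If s ++ t and t ++ s differ, the products of n factors equal to one or the
    other are 2 ^ n distinct words, as both have the same length. *)
Lemma subsemigroup_commutes L T C : quadratic_words L C -> (T `<=` L)%classic ->
  (forall u v, T u -> T v -> T (u ++ v)) ->
  forall s t, T s -> T t -> s ++ t = t ++ s.
Proof.
move=> qL TL Tcat s t Ts Tt; apply/eqP; apply: contraT => /eqP ne.
pose q := size (s ++ t).
pose c (b : bool) := if b then s ++ t else t ++ s.
have sc b : size (c b) = q by case: b; rewrite /q /c !size_cat // addnC.
have Tc b : T (c b) by case: b; exact: Tcat.
have injc : injective c by move=> [] [] //= e; case: ne; rewrite /= ?e // -e.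
pose code b := flatten (map c b).
have sz b : size (code b) = size b * q.
  by elim: b => //= b bs IH; rewrite /code /= size_cat sc -/(code bs) IH.
have Tcode b : b <> [::] -> T (code b).
  elim: b => // b [|b' bs] IH _; first by rewrite /code /= cats0.
  by rewrite /code /=; apply: Tcat => //; exact: IH.
have inj b b' : size b = size b' -> code b = code b' -> b = b'.
  elim: b b' => [|b bs IH] [|b' bs'] //= [] ss /eqP.
  rewrite /code /= eqseq_cat ?sc // => /andP[/eqP/injc -> /eqP/IH -> //].
have q0 : 0 < q.
  by rewrite lt0n; apply/negP => /eqP/size0nil/eqP; move: ne; case: (s) (t) => [|? ?] [|? ?].
have [n n0] := exp2_gt_square (C * q ^ 2).
have := qL (n * q) (map code (map val (enum {: n.-tuple bool}))) ltac:(lia).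
rewrite -map_comp map_inj_in_uniq ?enum_uniq; last first.
  by move=> b b' _ _ /= /inj e; apply: val_inj; apply: e; rewrite !size_tuple.
move=> /(_ isT); rewrite size_map -cardE card_tuple card_bool.
have h w : w \in map (code \o val) (enum {: n.-tuple bool}) -> L w /\ size w <= n * q.
  move=> /mapP[b _ ->] /=; rewrite sz size_tuple; split=> //; apply/TL/Tcode.
  by move=> b0; have := size_tuple b; rewrite b0 /= => e; rewrite -e in n0.
by move=> /(_ h); rewrite expnMn; lia.
Qed.

(** A word commuting with z is a prefix of a power of z, and every word of L is
    a factor of such a word; conversely T contains the powers of z. *)
Lemma periodic_of_commuting L T z : factorial L -> (T `<=` L)%classic ->
  (forall u v, T u -> T v -> T (u ++ v)) ->
  (forall s t, T s -> T t -> s ++ t = t ++ s) ->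
  (forall w, L w -> exists a b, T (a ++ w ++ b)) ->
  T z -> z <> [::] -> exists f, periodic (size z) f /\ L = factors f.
Proof.
move=> facL TL Tcat Tcom facT Tz; case: z Tz => // x z' Tz _.
set z := x :: z' in Tz *; pose p := size z.
have p0 : 0 < p by [].
pose f i := nth x z (i %% p).
have per : periodic p f by split=> // i; rewrite /f modnDr.
exists f; split=> //; rewrite eqEsubset; split=> w.
  move=> /facT[a [b Tt]]; apply: (@factors_factorial f a _ b).
  set t := a ++ w ++ b in Tt *; exists 0.
  apply: (@eq_from_nth _ x) => [|i lti]; first by rewrite size_map size_iota.
  rewrite (nth_map 0) ?size_iota // nth_iota // add0n.
  elim/ltn_ind: i lti => i IH lti.
  have : nth x (t ++ z) i = nth x (z ++ t) i by rewrite (Tcom _ _ Tt Tz).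
  rewrite nth_cat lti => ->; rewrite nth_cat -/p; case: ltnP => lip; first by rewrite /f modn_small.
  rewrite IH; try by lia.
  by rewrite /f -{2}(subnK lip) modnDr.
move=> [i ->].
have Tn n : T (map f (iota 0 (n.+1 * p))).
  elim: n => [|n IH].
    rewrite mul1n; suff -> : map f (iota 0 p) = z by [].
    apply: (@eq_from_nth _ x) => [|j ltj]; first by rewrite size_map size_iota.
    rewrite size_map size_iota in ltj.
    by rewrite (nth_map 0) ?size_iota // nth_iota // /f modn_small.
  rewrite mulSn addnC iotaD map_cat; apply: Tcat => //.
  suff -> : map f (iota (0 + n.+1 * p) p) = z by [].
  apply: (@eq_from_nth _ x) => [|j ltj]; first by rewrite size_map size_iota.
  rewrite size_map size_iota in ltj.
  by rewrite (nth_map 0) ?size_iota // nth_iota // /f add0n modnMDl modn_small.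
pose r := (i + size w).+1 * p - (i + size w).
have er : (i + size w).+1 * p = i + (size w + r).
  by have := leq_pmulr (i + size w).+1 p0; rewrite /r; lia.
apply: (facL (map f (iota 0 i)) _ (map f (iota (i + size w) r))); apply: TL.
have -> : map f (iota 0 i) ++ map f (iota i (size w)) ++
    map f (iota (i + size w) r) = map f (iota 0 ((i + size w).+1 * p)).
  by rewrite er iotaD add0n iotaD !map_cat.
exact: Tn.
Qed.

End PeriodicLanguages.

Import Order.TTheory GRing.Theory Num.Theory.
Local Open Scope classical_set_scope.
Local Open Scope ring_scope.

(** * Linear algebra *)

Section LinearAlgebra.
Variables (k : fieldType) (V : lmodType k).
Implicit Types (S U : set V) (u v : V).

Lemma lspan_ind S (P : V -> Prop) : P 0 ->
  (forall a u v, P u -> P v -> P (a *: u + v)) -> S `<=` P -> lspan S `<=` P.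
Proof.
move=> P0 PD SP; apply: smallest_sub => //; split=> [|a u v]; first exact/mem_set.
by rewrite !in_setE; exact: PD.
Qed.

Lemma lspan_closed S : GRing.submod_closed [in lspan S].
Proof.
split=> [|a u v]; first by apply/mem_set => U [cU _]; exact/set_mem/cU.1.
move=> /set_mem Su /set_mem Sv; apply/mem_set => U [cU SU].
by apply/set_mem/cU.2; apply/mem_set; [apply: Su|apply: Sv].
Qed.

Lemma lspan0 S : lspan S 0.
Proof. exact/set_mem/(lspan_closed S).1. Qed.

Lemma lspanDZ S a u v : lspan S u -> lspan S v -> lspan S (a *: u + v).
Proof.
by move=> Su Sv; apply/set_mem/(lspan_closed S).2; exact/mem_set.
Qed.

Lemma lspanZ S a u : lspan S u -> lspan S (a *: u).
Proof. by move=> Su; rewrite -[_ *: _]addr0; apply: lspanDZ => //; exact: lspan0. Qed.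

Lemma lspanD S u v : lspan S u -> lspan S v -> lspan S (u + v).
Proof. by move=> Su Sv; rewrite -[u]scale1r; exact: lspanDZ. Qed.

Lemma lspanN S u : lspan S u -> lspan S (- u).
Proof. by rewrite -scaleN1r; exact: lspanZ. Qed.

Lemma lspan_sum S (J : Type) (r : seq J) (P : pred J) (F : J -> V) :
  (forall j, P j -> lspan S (F j)) -> lspan S (\sum_(j <- r | P j) F j).
Proof.
move=> SF; elim/big_ind: _ => //; [exact: lspan0|exact: lspanD].
Qed.

Lemma sub_lspan S : S `<=` lspan S.
Proof. exact: sub_smallest. Qed.

Lemma lspan_le S U : S `<=` lspan U -> lspan S `<=` lspan U.
Proof. by apply: lspan_ind; [exact: lspan0|exact: lspanDZ]. Qed.

Lemma lspan_range n (b : 'I_n -> V) v : lspan (range b) v ->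
  exists c : 'I_n -> k, v = \sum_i c i *: b i.
Proof.
move: v; apply: (lspan_ind (P := fun v => exists c, v = \sum_i c i *: b i))
  => [|a u v [c ->] [c' ->]|_ [i _ <-]].
- by exists (fun=> 0); rewrite big1 // => i _; rewrite scale0r.
- exists (fun i => a * c i + c' i); rewrite scaler_sumr -big_split /=.
  by apply: eq_bigr => i _; rewrite scalerDl scalerA.
- exists (fun j => (j == i)%:R); rewrite (bigD1 i) //= eqxx scale1r big1 ?addr0 //.
  by move=> j /negPf ->; rewrite scale0r.
Qed.

Lemma linear_dependence m n (M : 'M[k]_(m, n)) : (n < m)%N ->
  exists2 c : 'rV[k]_m, c *m M = 0 & exists i, c 0 i != 0.
Proof.
move=> ltnm; have /rowV0Pn[c /sub_kermxP cM c0] : kermx M != 0.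
  rewrite kermx_eq0 /row_free; apply: contraTneq ltnm => rM.
  by rewrite -leqNgt -rM rank_leq_col.
exists c => //; have /matrix0Pn[i [j cij]] := c0.
by exists j; rewrite -[0](ord1 i).
Qed.

Lemma steinitz m n (e : 'I_m -> V) (b : 'I_n -> V) :
  lin_indep e -> (forall i, lspan (range b) (e i)) -> (m <= n)%N.
Proof.
move=> indep sp; rewrite leqNgt; apply/negP => ltnm.
have /choice[M eM] : forall i, exists c : 'I_n -> k, e i = \sum_j c j *: b j.
  by move=> i; exact: lspan_range.
have [c cM [i]] := linear_dependence (\matrix_(i, j) M i j) ltnm.
rewrite (indep (fun i => c 0 i)) ?eqxx //.
under eq_bigr => l _ do rewrite eM scaler_sumr.
rewrite exchange_big /= big1 // => j _.
under eq_bigr do rewrite scalerA.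
rewrite -scaler_suml; have /matrixP/(_ 0 j) := cM; rewrite !mxE => h.
suff -> : \sum_i0 c 0 i0 * M i0 j = 0 by rewrite scale0r.
by rewrite -[RHS]h; apply: eq_bigr => l _; rewrite mxE.
Qed.

Definition rank_ge U m := exists e : 'I_m -> V, lin_indep e /\ forall i, U (e i).

Lemma rank_ge_leq U m n (b : 'I_n -> V) : rank_ge U m ->
  U `<=` lspan (range b) -> (m <= n)%N.
Proof. by move=> [e [indep Ue]] sub; apply: (steinitz indep) => i; apply: sub. Qed.

Lemma rank_ge_sub U U' m : U `<=` U' -> rank_ge U m -> rank_ge U' m.
Proof. by move=> sub [e [indep Ue]]; exists e; split=> // i; exact: sub. Qed.

Lemma rank_geS U m v (e : 'I_m -> V) : lin_indep e -> (forall i, U (e i)) ->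
  U v -> ~ lspan (range e) v ->
  rank_ge U m.+1.
Proof.
move=> indep Ue Uv nv; exists (fun i => oapp e v (unlift ord0 i)); split; last first.
  by move=> i; case: unliftP => [j _|_] /=.
move=> c; rewrite big_ord_recl unlift_none /=.
under eq_bigr do rewrite liftK /=.
move=> c0; have cv0 : c ord0 = 0.
  apply: contra_notP nv => /eqP nz.
  have -> : v = (c ord0)^-1 *: (- \sum_i c (lift ord0 i) *: e i).
    rewrite -[X in - X](addKr (c ord0 *: v)) c0 addr0 opprK scalerA mulVf //.
    by rewrite scale1r.
  apply: lspanZ; apply: lspanN; apply: lspan_sum => i _; apply: lspanZ.
  by apply: sub_lspan; exists i.
move: c0; rewrite cv0 scale0r add0r => /indep ce i.
by case: (unliftP ord0 i) => [j ->|-> //]; exact: ce.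
Qed.

Lemma has_dim_rank U m : has_dim U m -> rank_ge U m.
Proof.
by move=> [b [indep <-]]; exists b; split=> // i; apply: sub_lspan; exists i.
Qed.

Lemma has_dim_leq U m n : has_dim U n -> rank_ge U m -> (m <= n)%N.
Proof. by move=> [b [_ <-]] rk; exact: (rank_ge_leq (b := b) rk (fun _ h => h)). Qed.

Lemma subspace_dimE U n : has_dim U n -> subspace_dim U = n.
Proof.
move=> dU; rewrite /subspace_dim; case: xgetP => [m _ /= dU'|/(_ n dU) []].
by apply/eqP; rewrite eqn_leq (has_dim_leq dU (has_dim_rank dU'))
  (has_dim_leq dU' (has_dim_rank dU)).
Qed.

Lemma subspace_dim_gt0 U : (0 < subspace_dim U)%N -> has_dim U (subspace_dim U).
Proof. by rewrite /subspace_dim; case: xgetP => // m ->. Qed.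
End LinearAlgebra.

(** Linearly independent families in the kernel and over the image of a linear
    map fit together. *)
Lemma rank_ge_kernel (k : fieldType) (V W : lmodType k) (h : V -> W)
    (U U' : set V) m m' : linear h ->
  rank_ge [set h u | u in U] m -> rank_ge U' m' -> (forall u, U' u -> h u = 0) ->
  rank_ge (U `|` U') (m + m').
Proof.
move=> hlin [e [inde Ue]] [e' [inde' Ue']] hU'.
pose H : {linear V -> W} := HB.pack h (GRing.isLinear.Build k V W _ h hlin).
have hZ a u : h (a *: u) = a *: h u by exact: (linearZ_LR H).
have /choice[u uP] : forall i, exists u, U u /\ h u = e i.
  by move=> i; have [u Uu hu] := Ue i; exists u.
exists (fun i => match fintype.split i with inl j => u j | inr j => e' j end); split; last first.
  by move=> i; case: (fintype.split i) => j; [left; case: (uP j)|right].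
move=> c; rewrite big_split_ord /=.
under eq_bigr do rewrite (unsplitK (inl _)).
under [X in _ + X]eq_bigr do rewrite (unsplitK (inr _)).
move=> c0; have cl : forall i, c (lshift m' i) = 0.
  apply: inde; have := congr1 H c0; rewrite linear0 linearD !linear_sum /=.
  rewrite [X in _ + X]big1 ?addr0 => [h0|i _]; last by rewrite /= hZ hU' ?scaler0.
  rewrite -[RHS]h0; apply: eq_bigr => i _.
  by rewrite /= hZ; case: (uP i) => _ ->.
move: c0; rewrite big1 ?add0r => [/inde' cr i|i _]; last by rewrite cl scale0r.
by case: (split_ordP i) => j ->.
Qed.

(** * Right ideals generated by words *)

Definition prime_ring (B : nzRingType) :=
  forall a b : B, (forall c, a * c * b = 0) -> a = 0 \/ b = 0.

(** The elements u with u A b inside P form an ideal J, and those v with J A v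
    inside P form an ideal K; their product lies in P. *)
Lemma prime_ideal_elementwise (A : nzRingType) (P : set A) : prime_ideal P ->
  forall a b, (forall c, P (a * c * b)) -> P a \/ P b.
Proof.
move=> [[[P0 PB] PM] _ prP] a b abP.
have P0' : P 0 by exact/set_mem.
have PB' u v : P u -> P v -> P (u - v).
  by move=> /mem_set Pu /mem_set Pv; exact/set_mem/PB.
pose J := [set u | forall c, P (u * c * b)].
pose K := [set v | forall u c, J u -> P (u * c * v)].
have tJ : two_sided_ideal J.
  split; first split.
  - by apply/mem_set => c; rewrite !mul0r.
  - move=> u v /set_mem Ju /set_mem Jv; apply/mem_set => c.
    by rewrite !mulrBl; exact: PB'.
  - move=> u v Jv; split=> c; last by rewrite -[v * u * c]mulrA; exact: Jv.
    by rewrite -!mulrA; apply: (PM u _ _).1; rewrite mulrA; exact: Jv.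
have tK : two_sided_ideal K.
  split; first split.
  - by apply/mem_set => u c _; rewrite mulr0.
  - move=> u v /set_mem Ku /set_mem Kv; apply/mem_set => w c Jw.
    by rewrite mulrBr; apply: PB'; [exact: Ku|exact: Kv].
  - move=> u v Kv; split=> w c Jw; first by rewrite mulrA -[w * c * u]mulrA; exact: Kv.
    by rewrite mulrA; apply: (PM u _ _).2; exact: Kv.
have [] := prP J K tJ tK.
- by move=> u v Ju Kv; have := Kv u 1 Ju; rewrite mulr1.
- by move=> JP; left; exact: JP.
- by move=> KP; right; apply: KP => u c; exact.
Qed.

Lemma prime_algebra_ring (B : nzRingType) : prime_algebra B -> prime_ring B.
Proof. by move=> /prime_ideal_elementwise pr a b /pr. Qed.

Section Evaluation.
Variables (B : nzRingType) (d : nat) (x : 'I_d -> B).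

Definition ev (w : seq 'I_d) : B := \prod_(i <- w) x i.

Lemma ev_cat u v : ev (u ++ v) = ev u * ev v.
Proof. by rewrite /ev big_cat. Qed.

Lemma ev_nil : ev [::] = 1.
Proof. by rewrite /ev big_nil. Qed.
End Evaluation.

Section GeneratedAlgebra.
Variables (k : fieldType) (B : algType k) (d : nat) (x : 'I_d -> B).
Implicit Types (b c : B).
Local Notation ev := (ev x).

Definition nonzero_words : set (seq 'I_d) := [set w | ev w <> 0].

Definition deg_le n : set B := lspan (ev @` [set w | (size w <= n)%N]).

Definition generating := forall b, exists n, deg_le n b.

Definition bounded_degree := exists n, forall b, deg_le n b.

Lemma nonzero_words_nil : nonzero_words [::].
Proof. by rewrite /nonzero_words /= ev_nil; apply/eqP; exact: oner_neq0. Qed.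

Lemma nonzero_words_factorial : factorial nonzero_words.
Proof.
by move=> u w v; rewrite /nonzero_words /= !ev_cat => h e; apply: h;
  rewrite e mul0r mulr0.
Qed.

Lemma deg_le_ev n w : (size w <= n)%N -> deg_le n (ev w).
Proof. by move=> le; apply: sub_lspan; exists w. Qed.

Lemma deg_leW m n : (m <= n)%N -> deg_le m `<=` deg_le n.
Proof.
move=> le; apply: lspan_le => _ [w /= lew <-]; apply: deg_le_ev.
exact: leq_trans lew le.
Qed.

Lemma deg_leM m n b c : deg_le m b -> deg_le n c -> deg_le (m + n) (b * c).
Proof.
move=> mb nc; move: b mb; apply: (lspan_ind (P := fun b => deg_le (m + n) (b * c))).
- by rewrite mul0r; exact: lspan0.
- by move=> a u v ? ?; rewrite mulrDl -scalerAl; exact: lspanDZ.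
move=> _ [u /= leu <-]; move: c nc.
apply: (lspan_ind (P := fun c => deg_le (m + n) (ev u * c))).
- by rewrite mulr0; exact: lspan0.
- by move=> a w v ? ?; rewrite mulrDr -scalerAr; exact: lspanDZ.
move=> _ [v /= lev <-]; rewrite -ev_cat; apply: deg_le_ev.
by rewrite size_cat leq_add.
Qed.

Lemma deg_le_ind n (P : B -> Prop) : P 0 ->
  (forall (a : k) b c, P b -> P c -> P (a *: b + c)) ->
  (forall w, (size w <= n)%N -> P (ev w)) -> deg_le n `<=` P.
Proof. by move=> P0 PD Pw; apply: lspan_ind => // _ [w /= lew <-]; exact: Pw. Qed.

Lemma gen_ind (P : B -> Prop) : generating -> P 0 ->
  (forall (a : k) b c, P b -> P c -> P (a *: b + c)) ->
  (forall w, P (ev w)) -> forall b, P b.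
Proof. by move=> gen P0 PD Pw b; have [n] := gen b; move: b; apply: deg_le_ind. Qed.

Lemma deg_le_finite n : exists s (q : 'I_s -> B),
  deg_le n `<=` lspan (range q) /\ forall i, deg_le n (q i).
Proof.
exists #|{: n.-bseq 'I_d}|, (fun i => ev (enum_val i : n.-bseq 'I_d)); split.
  apply: lspan_le => _ [w /= lew <-]; apply: sub_lspan.
  by exists (enum_rank (Bseq lew)); rewrite // enum_rankK.
by move=> i; apply: deg_le_ev; exact: size_bseq.
Qed.

Lemma unbounded_rank m : generating -> ~ bounded_degree -> rank_ge [set: B] m.
Proof.
move=> gen unb; elim: m => [|m [e [indep _]]].
  by exists (fun=> 0); split=> // c _ [].
have /choice[N NP] : forall i, exists n, deg_le n (e i) by move=> i; exact: gen.
pose n := \max_i N i.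
have en i : deg_le n (e i).
  by apply: deg_leW (NP i); exact: (leq_bigmax (F := N)).
have [v nv] : exists v, ~ deg_le n v.
  by apply: contrapT => h; apply: unb; exists n => b; apply: contrapT => nb; apply: h; exists b.
apply: (rank_geS (v := v) indep) => // h; apply: nv.
by apply: (lspan_le _ h) => _ [i _ <-]; exact: en.
Qed.

Hypothesis gen : generating.
Hypothesis prB : prime_ring B.

Lemma nonzero_words_prime : prime_language nonzero_words.
Proof.
split; first exact: nonzero_words_factorial.
move=> u v nu nv; apply: contrapT => h.
have [|//|//] := prB (a := ev u) (b := ev v).
apply: gen_ind => //.
- by rewrite mulr0 mul0r.
- by move=> a b c h1 h2; rewrite mulrDr mulrDl -scalerAr -scalerAl h1 h2 scaler0 addr0.
- move=> w; rewrite -!ev_cat -catA; apply: contrapT => nz; apply: h.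
  by exists w.
Qed.

(** If the products of b with the elements of degree at most n stopped growing,
    b B would be a finite-dimensional right ideal. Its right annihilator has
    finite codimension, hence is nonzero, which contradicts primeness. *)
Lemma right_ideal_grows b n : ~ bounded_degree -> b <> 0 ->
  exists2 v, deg_le n.+1 v & ~ [set b * w | w in deg_le n] (b * v).
Proof.
move=> unb b0; apply: contrapT => h.
have stop v : deg_le n.+1 v -> exists2 w, deg_le n w & b * v = b * w.
  move=> nv; apply: contrapT => nw; apply: h; exists v => // -[w nw' e].
  by apply: nw; exists w.
have stops : forall v, exists2 w, deg_le n w & b * v = b * w.
  apply: gen_ind => //.
  - by exists 0; [exact: lspan0|].
  - move=> a v v' [w nw e] [w' nw' e']; exists (a *: w + w'); first exact: lspanDZ.
    by rewrite !mulrDr -!scalerAr e e'.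
  - elim/last_ind => [|w i [v nv e]]; first by exists (ev [::]) => //; exact: deg_le_ev.
    rewrite -cats1 ev_cat mulrA e -mulrA; apply: stop.
    by rewrite -addn1; apply: deg_leM => //; exact: deg_le_ev.
have [s [q [sq nq]]] := deg_le_finite n.
have spanq v : exists c : 'I_s -> k, b * v = \sum_l c l *: (b * q l).
  have [w /sq/lspan_range[c ->] ->] := stops v; exists c.
  by rewrite mulr_sumr; apply: eq_bigr => l _; rewrite scalerAr.
(* right multiplication by e j acts on b B by a matrix indexed by J *)
pose J : finType := ('I_s * 'I_s)%type.
have [e [indep _]] := unbounded_rank #|J|.+1 gen unb.
have /choice[M MP] : forall ji : 'I_#|J|.+1 * 'I_s, exists c : 'I_s -> k,
    b * (q ji.2 * e ji.1) = \sum_l c l *: (b * q l) by move=> ji; exact: spanq.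
have [c cM [j0 cj0]] := linear_dependence
  (\matrix_(j < #|J|.+1, r < #|J|) M (j, (enum_val r).1) (enum_val r).2) (ltnSn _).
pose z := \sum_j c 0 j *: e j.
have z0 : z <> 0 by move/indep/(_ j0)/eqP; rewrite (negPf cj0).
have qz i : b * q i * z = 0.
  rewrite mulr_sumr; transitivity (\sum_l (\sum_j c 0 j * M (j, i) l) *: (b * q l)).
    under eq_bigr do rewrite -scalerAr -mulrA (MP (_, i)) scaler_sumr.
    rewrite exchange_big; apply: eq_bigr => l _; rewrite scaler_suml.
    by apply: eq_bigr => j _; rewrite scalerA.
  apply: big1 => l _; have /matrixP/(_ 0 (enum_rank (i, l))) := cM.
  rewrite !mxE => h0; suff -> : \sum_j c 0 j * M (j, i) l = 0 by rewrite scale0r.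
  by rewrite -[RHS]h0; apply: eq_bigr => j _; rewrite mxE enum_rankK.
have [|//|//] := prB (a := b) (b := z).
move=> v; have [f ->] := spanq v; rewrite mulr_suml big1 // => l _.
by rewrite -scalerAl qz scaler0.
Qed.

Lemma right_ideal_rank b n : ~ bounded_degree -> b <> 0 ->
  rank_ge [set b * v | v in deg_le n] n.+1.
Proof.
move=> unb b0; elim: n => [|n [e [indep be]]].
  exists (fun=> b); split=> [c|_]; last by exists 1; rewrite ?mulr1 // -(ev_nil x); exact: deg_le_ev.
  rewrite big_ord1 => /eqP; rewrite scaler_eq0 => /orP[/eqP c0 i|/eqP//].
  by rewrite ord1.
have [v nv nbv] := right_ideal_grows n unb b0.
apply: (rank_geS (v := b * v) indep).
- by move=> i; have [w nw <-] := be i; exists w => //; exact: deg_leW nw.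
- by exists v.
- move=> h; apply: nbv; move: (b * v) h; apply: lspan_ind.
  + by exists 0; [exact: lspan0|rewrite mulr0].
  + move=> a _ _ [w nw <-] [w' nw' <-]; exists (a *: w + w'); first exact: lspanDZ.
    by rewrite mulrDr scalerAr.
  + by move=> _ [i _ <-].
Qed.

(** A weak form of uniformity of the right ideal u B, tested only on the
    endomorphisms that left multiplication by words induces. *)
Definition good_word u := nonzero_words u /\
  forall y, nonzero_words (u ++ y ++ u) ->
  forall b, ev (u ++ y) * (ev u * b) = 0 -> ev u * b = 0.

(** If u is not good, some left multiplication maps u B onto a nonzero right
    ideal u' B generated by a word, with nonzero kernel. The growth of u B is
    thus at least that of u' B plus that of a nonzero right ideal, and the same
    applies to u', and so on. *)
Lemma no_good_word_growth (g : nat -> nat) :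
  (forall b n, b <> 0 -> rank_ge [set b * v | v in deg_le n] (g n)) ->
  (forall u, ~ good_word u) ->
  forall t u, nonzero_words u ->
  exists c : nat, forall n, rank_ge [set ev u * v | v in deg_le (n + c)] (t * g n).
Proof.
move=> rk ng; elim=> [|t IH] u nu.
  by exists 0 => n; exists (fun=> 0); split=> [c _ []|[]].
have [y [nuyu [b ker nub]]] : exists y, nonzero_words (u ++ y ++ u) /\
    exists2 b, ev (u ++ y) * (ev u * b) = 0 & ev u * b <> 0.
  apply: contrapT => h; apply: (ng u); split=> // y ny b kb.
  by apply: contrapT => nz; apply: h; exists y; split=> //; exists b.
have [c' cP] := IH _ nuyu; have [e be] := gen b; exists (c' + e)%N => n.
have -> : (t.+1 * g n = t * g n + g n)%N by rewrite mulSn addnC.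
have h := rank_ge_kernel (h := fun v => ev (u ++ y) * v)
  (U := [set ev u * v | v in deg_le (n + c')])
  (U' := [set ev u * b * v | v in deg_le n]) (m := t * g n) (m' := g n).
apply: rank_ge_sub; last apply: h.
- move=> _ [] [v nv <-]; first by exists v => //; apply: deg_leW nv; lia.
  exists (b * v); rewrite ?mulrA //; apply: (deg_leW (m := e + n)); first lia.
  exact: deg_leM.
- by move=> a v w; rewrite mulrDr scalerAr.
- apply: rank_ge_sub (cP n) => _ [v nv <-]; exists (ev u * v); first by exists v.
  by rewrite !ev_cat !mulrA.
- exact: (rk _ _ nub).
- by move=> _ [v _ <-]; rewrite mulrA ker mul0r.
Qed.

(** In finite dimension, constant lower bounds on the growth of the nonzero
    right ideals already exclude arbitrarily large t. *)
Lemma good_word_bounded : bounded_degree -> exists u, good_word u.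
Proof.
move=> [n0 bd]; apply: contrapT => h.
have [s [q [sq _]]] := deg_le_finite n0.
have [|u gu|c /(_ 0)] := no_good_word_growth (g := fun=> 1) _ _ s.+1 nonzero_words_nil.
- move=> b n b0; exists (fun=> b); split=> [c|_].
    rewrite big_ord1 => /eqP; rewrite scaler_eq0 => /orP[/eqP c0 i|/eqP//].
    by rewrite ord1.
  by exists 1; rewrite ?mulr1 // -(ev_nil x); exact: deg_le_ev.
- by apply: h; exists u.
rewrite muln1 => /(rank_ge_leq (b := q)); rewrite ltnn => /(_ _) h0.
by have : false by apply: h0 => b _; exact: sq.
Qed.

(** Nonzero right ideals grow at least linearly, so t of them would exceed the
    linear growth of B as soon as t > D. *)
Lemma good_word_linear D : ~ bounded_degree ->
  (forall n m, rank_ge (deg_le n) m -> (m <= D * n.+1)%N) -> exists u, good_word u.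
Proof.
move=> unb lin; apply: contrapT => h.
have [|u gu|c cP] := no_good_word_growth (g := succn) _ _ D.+1 nonzero_words_nil.
- by move=> b n; exact: right_ideal_rank.
- by apply: h; exists u.
have := lin (D * c + c)%N (D.+1 * (D * c).+1)%N.
have rk : rank_ge (deg_le (D * c + c)) (D.+1 * (D * c).+1).
  by apply: rank_ge_sub (cP _) => _ [v nv <-]; rewrite ev_nil mul1r.
by move=> /(_ rk); nia.
Qed.

(** The words that lead from a good word u back to u form a semigroup: the
    product of two of them is nonzero by injectivity. Since there are too few
    words for a free semigroup, it is commutative; and by primeness every
    nonzero word is a factor of one of its elements. *)
Lemma good_word_periodic C u : good_word u -> quadratic_words nonzero_words C ->
  nonzero_words `<=` [set [::]] \/
  exists p f, periodic p f /\ nonzero_words = factors f.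
Proof.
move=> [nu good] qL; have [facL prL] := nonzero_words_prime.
pose T : set (seq 'I_d) := [set w | exists2 y, w = y ++ u & nonzero_words (u ++ w)].
have TL : T `<=` nonzero_words.
  by move=> w [y _ nw]; apply: (facL u w [::]); rewrite cats0.
have Tcat v w : T v -> T w -> T (v ++ w).
  move=> [y -> ny] [y' -> ny']; exists (y ++ u ++ y'); rewrite ?catA //.
  move: ny'; rewrite /nonzero_words /= -!catA !ev_cat => ny' e; apply: ny'.
  apply: (good y ny (ev y' * ev u)).
  by rewrite !ev_cat -!mulrA.
have facT w : nonzero_words w -> exists s t, T (s ++ w ++ t).
  move=> nw; have [y ny] := prL _ _ nu nw; have [y' ny'] := prL _ _ ny nu.
  exists y, (y' ++ u); exists (y ++ w ++ y'); rewrite ?catA //.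
  by move: ny'; rewrite -!catA.
have [|/existsNP[w /not_implyP[nw w0]]] :=
  pselect (forall w, nonzero_words w -> w = [::]); first by left.
right; have [a [b Tz]] := facT _ nw.
have [||f [pf eL]] := periodic_of_commuting facL TL Tcat _ facT Tz.
- exact: subsemigroup_commutes qL TL Tcat.
- by case: (a) (w) w0 => [|? ?] [|? ?].
by exists (size (a ++ w ++ b)), f.
Qed.
End GeneratedAlgebra.

(** * Normal words and growth *)

Section WordsUpto.
Variables (X : finType) (L : set (seq X)).

Definition words_of_size n : seq (seq X) :=
  map val (enum [set t : n.-tuple X | `[< L t >]]%SET).

Fixpoint words_upto n : seq (seq X) :=
  (if n is m.+1 then words_upto m else [::]) ++ words_of_size n.

Lemma mem_words_of_size n w : (w \in words_of_size n) = (size w == n) && `[< L w >].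
Proof.
apply/mapP/andP => [[t]|[sw Lw]].
  by rewrite mem_enum finset.in_set => Lt ->; rewrite size_tuple.
by exists (Tuple sw); rewrite // mem_enum finset.in_set.
Qed.

Lemma mem_words_upto n w : (w \in words_upto n) = (size w <= n)%N && `[< L w >].
Proof.
elim: n => [|n IH]; first by rewrite mem_words_of_size leqn0.
by rewrite mem_cat IH mem_words_of_size -andb_orl [in RHS]leq_eqVlt ltnS orbC.
Qed.

Lemma words_upto_uniq n : uniq (words_upto n).
Proof.
have us m : uniq (words_of_size m) by rewrite map_inj_uniq ?enum_uniq //; exact: val_inj.
elim: n => [|n IH]; first exact: us.
rewrite cat_uniq IH us andbT; apply/hasPn => w.
by rewrite mem_words_of_size mem_words_upto => /andP[/eqP -> _]; rewrite ltnn.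
Qed.

Lemma size_words_upto n : size (words_upto n) = (\sum_(i < n.+1) count_words L i)%N.
Proof.
elim: n => [|n IH]; first by rewrite big_ord1 /= size_map -cardE.
by rewrite big_ord_recr /= -IH size_cat size_map -cardE.
Qed.
End WordsUpto.

Section Code.
Variable d : nat.
Implicit Types (u v w : seq 'I_d).

(** Numeration in base d + 1 with the nonzero digits lists the words by degree
    and then lexicographically. *)
Definition code w := foldl (fun n (i : 'I_d) => n * d.+1 + i.+1)%N 0%N w.

Lemma code_cat u w : code (u ++ w) = (code u * d.+1 ^ size w + code w)%N.
Proof.
elim/last_ind: w => [|w i IH]; first by rewrite cats0 muln1 addn0.
have code_rcons u' : code (rcons u' i) = (code u' * d.+1 + i.+1)%N.
  by rewrite /code foldl_rcons.
by rewrite -rcons_cat !code_rcons IH size_rcons expnSr mulnDl mulnA addnA.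
Qed.

Lemma code_cons i w : code (i :: w) = (i.+1 * d.+1 ^ size w + code w)%N.
Proof. by rewrite -cat1s code_cat. Qed.

Lemma code_lt w : (code w < d.+1 ^ size w)%N.
Proof.
elim: w => // i w IH; rewrite code_cons /= expnS.
by have := ltn_ord i; nia.
Qed.

Lemma code_ltW v w : (code v <= code w)%N -> (size v <= size w)%N.
Proof.
rewrite leqNgt [in X in _ -> X]leqNgt; apply: contra; case: v => // i v.
rewrite ltnS code_cons => le.
apply: leq_trans (code_lt w) _; apply: leq_trans (leq_addr _ _).
by rewrite mulSn; apply: leq_trans (leq_addr _ _); rewrite leq_pexp2l.
Qed.

Lemma code_inj : injective code.
Proof.
move=> v w e; have : size v = size w by apply/eqP; rewrite eqn_leq !code_ltW // e.
elim: v w e => [|i v IH] [|j w] //= e [] sz.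
have lv := code_lt v; have lw := code_lt w; rewrite !code_cons -sz in e lw.
have ij : i = j :> nat by nia.
by congr (_ :: _); [exact: val_inj|apply: IH => //; nia].
Qed.

Lemma code_mono u v w y : (code v < code w)%N -> (code (u ++ v ++ y) < code (u ++ w ++ y))%N.
Proof.
move=> lt; have le := code_ltW (ltnW lt); rewrite !code_cat !size_cat !expnD.
have h1 : (d.+1 ^ size v <= d.+1 ^ size w)%N by rewrite leq_pexp2l.
have h2 : (0 < d.+1 ^ size y)%N by rewrite expn_gt0.
have h3 : (code v * d.+1 ^ size y < code w * d.+1 ^ size y)%N by rewrite ltn_pmul2r.
have h4 : (code u * (d.+1 ^ size v * d.+1 ^ size y) <=
  code u * (d.+1 ^ size w * d.+1 ^ size y))%N by rewrite leq_mul2l leq_mul2r h1 !orbT.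
lia.
Qed.
End Code.

Section NormalWords.
Variables (k : fieldType) (B : algType k) (d : nat) (x : 'I_d -> B).
Local Notation ev := (ev x).
Local Notation deg_le := (deg_le x).

(** The words that are not leading words of relations between the generators:
    they index a basis of B adapted to the degree. *)
Definition normal_words : set (seq 'I_d) :=
  [set w | ~ lspan (ev @` [set v | (code v < code w)%N]) (ev w)].

Lemma normal_words_factorial : factorial normal_words.
Proof.
move=> u w v; apply: contra_not => sp; rewrite !ev_cat mulrA.
pose S := ev @` [set y | (code y < code (u ++ w ++ v))%N].
move: (ev w) sp; apply: (lspan_ind (P := fun c => lspan S (ev u * c * ev v))).
- by rewrite mulr0 mul0r; exact: lspan0.
- by move=> a b c ? ?; rewrite mulrDr mulrDl -scalerAr -scalerAl; exact: lspanDZ.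
- move=> _ [y /= lty <-]; apply: sub_lspan; exists (u ++ y ++ v) => /=.
    exact: code_mono.
  by rewrite !ev_cat mulrA.
Qed.

Lemma normal_words_span w :
  lspan (ev @` [set v | normal_words v /\ (size v <= size w)%N]) (ev w).
Proof.
have [n] := ubnP (code w); elim: n w => // n IH w ltw.
have [nw|/contrapT sp] := pselect (normal_words w); first by apply: sub_lspan; exists w.
apply: (lspan_le _ sp) => _ [v /= ltv <-].
apply: (lspan_le _ (IH v (leq_trans ltv ltw))) => _ [y [ny ley] <-].
apply: sub_lspan; exists y => //; split=> //; apply: leq_trans ley _.
exact/code_ltW/ltnW.
Qed.

Lemma dim_deg_le n : has_dim (deg_le n) (\sum_(i < n.+1) count_words normal_words i).
Proof.
rewrite -size_words_upto; set s := words_upto normal_words n.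
exists (fun i => ev (nth [::] s i)); split; last first.
  rewrite eqEsubset; split; apply: lspan_le.
    move=> _ [i _ <-]; apply: deg_le_ev.
    by have := mem_nth [::] (ltn_ord i); rewrite mem_words_upto => /andP[].
  move=> _ [w /= lew <-]; apply: (lspan_le _ (@normal_words_span w)) => _ [v [nv lev] <-].
  have vs : v \in s by rewrite mem_words_upto (leq_trans lev lew); exact/asboolP.
  apply: sub_lspan; rewrite -index_mem in vs; exists (Ordinal vs) => //=.
  by rewrite nth_index // -index_mem.
move=> c c0 i0; apply/eqP; apply: contraT => ci0.
have [i ci maxi] := @arg_maxnP _ i0 (fun i => c i != 0) (fun i => code (nth [::] s i)) ci0.
have := mem_nth [::] (ltn_ord i); rewrite mem_words_upto => /andP[_ /asboolP].
case; move: c0; rewrite (bigD1 i) //=; set r := \sum_(j | _) _ => e.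
have -> : ev (nth [::] s i) = - ((c i)^-1 *: r).
  have -> : r = - (c i *: ev (nth [::] s i)).
    by apply/eqP; rewrite -addr_eq0 addrC e.
  by rewrite scalerN opprK scalerA mulVf // scale1r.
apply: lspanN; apply: lspanZ; apply: lspan_sum => j ji.
have [->|cj] := eqVneq (c j) 0; first by rewrite scale0r; exact: lspan0.
apply: lspanZ; apply: sub_lspan; exists (nth [::] s j) => //=.
rewrite ltn_neqAle (maxi j cj : (_ <= _)%N) andbT; apply: contra ji => /eqP/code_inj/eqP.
by rewrite nth_uniq // words_upto_uniq.
Qed.

(** Bergman's gap: the normal words have the same growth as B and form a
    factorial language. *)
Lemma linear_growth : (exists n, count_words normal_words n <= n)%N ->
  exists D, forall n m, rank_ge (deg_le n) m -> (m <= D * n.+1)%N.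
Proof.
move=> [n0 le]; have [D DP] := count_words_bounded normal_words_factorial le.
exists D => n m /(has_dim_leq (dim_deg_le n)) lem; apply: leq_trans lem _.
apply: leq_trans (_ : \sum_(i < n.+1) D <= _)%N; first by apply: leq_sum => i _.
by rewrite sum_nat_const card_ord mulnC.
Qed.

Lemma quadratic_lower_bound n : (forall i, i < count_words normal_words i)%N ->
  (n ^ 2 <= 2 * subspace_dim (deg_le n))%N.
Proof.
move=> lt; rewrite (subspace_dimE (dim_deg_le n)).
elim: n => // n IH; rewrite big_ord_recr /= mulnDr.
by move: (2 * _)%N IH (lt n.+1) => S; rewrite -!mulnn; lia.
Qed.
End NormalWords.

Section PeriodicRelation.
Variables (k : fieldType) (B : algType k) (d : nat) (x : 'I_d -> B).
Local Notation ev := (ev x).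
Local Notation deg_le := (deg_le x).
Local Notation nonzero_words := (nonzero_words x).

(** Words of a periodic language that start at the same phase are determined by
    their length. So a relation between nonzero words, multiplied on the left
    by a word y of one period that fixes the phase, expresses a nonzero word v
    by shorter ones; as v occurs in every long word, the degree is bounded. *)
Lemma periodic_relation p (f : nat -> 'I_d) (s : seq (seq 'I_d)) (c : seq 'I_d -> k) :
  generating x -> periodic p f -> nonzero_words = factors f ->
  {in s, forall w, nonzero_words w} -> \sum_(w <- s) c w *: ev w = 0 ->
  uniq s -> has (fun w => c w != 0) s -> bounded_degree x.
Proof.
move=> gen pf eL sL rel us nz; have [p0 per] := pf.
have [w0 [w0s cw0 maxw0]] : exists w0, [/\ w0 \in s, c w0 != 0 &
    forall w, w \in s -> c w != 0 -> (size w <= size w0)%N].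
  elim: (s) nz => //= w s' IH.
  have [/IH [w0 [w0s cw0 mx]] _|/hasPn no] := boolP (has (fun w => c w != 0) s').
    have [lt|le] := ltnP (size w0) (size w); last first.
      exists w0; rewrite inE w0s orbT; split=> // v; rewrite inE => /orP[/eqP ->//|].
      exact: mx.
    have [cw|/negPn/eqP cw] := boolP (c w != 0).
      exists w; rewrite inE eqxx; split=> // v; rewrite inE => /orP[/eqP ->//|vs cv].
      exact: leq_trans (mx v vs cv) (ltnW lt).
    exists w0; rewrite inE w0s orbT; split=> // v; rewrite inE => /orP[/eqP ->|].
      by rewrite cw eqxx.
    exact: mx.
  rewrite orbF => cw; exists w; rewrite inE eqxx; split=> // v.
  by rewrite inE => /orP[/eqP ->//|/no/negPn/eqP ->]; rewrite eqxx.
have := sL _ w0s; rewrite eL => -[i ew0].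
have {}ew0 : w0 = map f (iota i (size w0)) := ew0.
set l := size w0 in ew0 maxw0 *.
pose y := map f (iota i p).
have sy : size y = p by rewrite size_map size_iota.
have wE w : nonzero_words (y ++ w) -> w = map f (iota i (size w)).
  rewrite eL => -[j]; rewrite size_cat sy iotaD map_cat.
  move=> /eqP; rewrite eqseq_cat ?sy ?size_map ?size_iota // => /andP[/eqP eyj /eqP {1}->].
  apply: eq_window => m _.
  have fm m' : (m' < p)%N -> f (i + m')%N = f (j + m')%N.
    move=> lt; have x0 := f 0%N.
    have := congr1 (nth x0 ^~ m') eyj.
    by rewrite /y !(nth_map 0%N) ?size_iota // !nth_iota.
  rewrite -addnA (addnC p) addnA per.
  have em : m = (m %% p + m %/ p * p)%N by rewrite addnC -divn_eq.
  rewrite em !addnA !(periodicM _ pf) fm // ltn_mod //.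
pose v := y ++ w0.
have sv : size v = (p + l)%N by rewrite size_cat sy.
have evv : v = map f (iota i (p + l)).
  rewrite iotaD map_cat /v {1}ew0; congr cat; apply: eq_window => m _.
  by rewrite -addnA (addnC p) addnA per.
have short : deg_le (p + l).-1 (ev v).
  have : ev y * (\sum_(w <- s) c w *: ev w) = 0 by rewrite rel mulr0.
  rewrite (bigD1_seq w0) //= mulrDr -scalerAr -ev_cat -/v; set r := ev y * _ => e.
  have -> : ev v = - ((c w0)^-1 *: r).
    have -> : r = - (c w0 *: ev v) by apply/eqP; rewrite -addr_eq0 addrC e.
    by rewrite scalerN opprK scalerA mulVf // scale1r.
  apply: lspanN; apply: lspanZ; rewrite /r mulr_sumr big_seq_cond.
  apply: lspan_sum => w /andP[ws ww0]; rewrite -scalerAr -ev_cat.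
  have [->|cw] := eqVneq (c w) 0; first by rewrite scale0r; exact: lspan0.
  apply: lspanZ.
  have [->|/eqP nw] := eqVneq (ev (y ++ w)) 0; first exact: lspan0.
  apply: deg_le_ev; rewrite size_cat sy.
  rewrite -ltnS prednK ?ltn_add2l ?addn_gt0 ?p0 //.
  rewrite ltn_neqAle maxw0 // andbT; apply: contra ww0 => /eqP sw.
  by rewrite (wE w nw) sw -ew0.
(* t brings the occurrence of w at j to the phase i of v *)
have reduce w : (p + (p + l) < size w)%N -> deg_le (size w).-1 (ev w).
  move=> ltw; have [->|/eqP nw] := eqVneq (ev w) 0; first exact: lspan0.
  have : nonzero_words w by []; rewrite eL => -[j ew].
  pose t := ((i + j * p - j) %% p)%N.
  have ltp : (t < p)%N by rewrite ltn_mod.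
  have {}ew : w = map f (iota j (size w)) := ew.
  pose q := ((i + j * p - j) %/ p)%N.
  have eqt : (i + j * p - j = q * p + t)%N by exact: divn_eq.
  clearbody q t; have lej := leq_pmulr j p0.
  have fjt m : f (j + t + m)%N = f (i + m)%N.
    rewrite -(periodicM q pf) -(periodicM j pf (i + m)).
    by congr f; lia.
  pose r := (size w - t - (p + l))%N.
  have ew' : w = map f (iota j t) ++ v ++ map f (iota (j + t + (p + l)) r).
    rewrite {1}ew evv.
    have -> : map f (iota i (p + l)) = map f (iota (j + t) (p + l)).
      by apply: eq_window => m _; rewrite fjt.
    by rewrite -!map_cat -!iotaD; congr (map f (iota _ _)); rewrite /r; lia.
  have h1 : deg_le t (ev (map f (iota j t))).
    by apply: deg_le_ev; rewrite size_map size_iota.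
  have h2 : deg_le r (ev (map f (iota (j + t + (p + l)) r))).
    by apply: deg_le_ev; rewrite size_map size_iota.
  apply: (deg_leW (m := (t + ((p + l).-1 + r))%N)); first by rewrite /r; lia.
  by rewrite ew' ev_cat (ev_cat x v); apply: deg_leM h1 (deg_leM short h2).
exists (p + (p + l))%N; apply: gen_ind => //; first exact: lspan0.
  by move=> a b b'; exact: lspanDZ.
move=> w; have [n] := ubnP (size w); elim: n w => // n IH w ltw.
have [le|lt] := leqP (size w) (p + (p + l)); first exact: deg_le_ev.
apply: (lspan_le _ (reduce w lt)) => _ [w' /= lew' <-]; apply: IH; lia.
Qed.
End PeriodicRelation.

(** * Gelfand--Kirillov dimension one *)

Section LimSup.
Variable R : realType.
Implicit Types (u : nat -> \bar R) (l : \bar R).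
Local Open Scope ereal_scope.

Lemma limn_esup_le u l n0 : (forall n, (n0 <= n)%N -> u n <= l) -> limn_esup u <= l.
Proof.
move=> le; rewrite limn_esup_lim; apply: lime_le; first exact: is_cvg_esups.
exists n0 => // n /= len; apply: ge_ereal_sup => _ [m /= lem <-]; apply: le.
exact: leq_trans len lem.
Qed.

Lemma limn_esup_ge u l n0 : (forall n, (n0 <= n)%N -> l <= u n) -> l <= limn_esup u.
Proof.
move=> le; rewrite limn_esup_lim; apply: lime_ge; first exact: is_cvg_esups.
exists n0 => // n /= len; apply: le_trans (le n len) _; apply: ereal_sup_ubound.
by exists n => /=.
Qed.
End LimSup.

Section GKdim.
Variables (R : realType) (k : fieldType) (B : algType k) (d : nat) (x : 'I_d -> B).
Local Notation ev := (ev x).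
Local Notation deg_le := (deg_le x).

Lemma subspace_pow_deg_le n : subspace_pow (deg_le 1) n = deg_le n.
Proof.
elim: n => [|n IH] /=; rewrite eqEsubset; split; apply: lspan_le.
- by move=> _ ->; rewrite -(ev_nil x); exact: deg_le_ev.
- move=> _ [[|//] _ <-]; rewrite ev_nil; exact: sub_lspan.
- by move=> _ [u du [v dv <-]]; rewrite IH in dv; exact: (deg_leM du dv).
- move=> _ [[|i w] /= lew <-]; apply: sub_lspan.
    exists 1; first by rewrite -(ev_nil x); exact: deg_le_ev.
    exists 1; last by rewrite mulr1 ev_nil.
    by rewrite IH -(ev_nil x); exact: deg_le_ev.
  exists (ev [:: i]); first exact: deg_le_ev.
  exists (ev w); last by rewrite -ev_cat.
  by rewrite IH; exact: deg_le_ev.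
Qed.

Lemma frame_deg_le : generating x -> frame (deg_le 1).
Proof.
move=> gen; split.
- exact: lspan_closed.
- by eexists; exact: dim_deg_le.
- by rewrite -(ev_nil x); exact: deg_le_ev.
rewrite /generates eqEsubset; split=> // b _ S [[S1 SZ SM] sub].
apply/set_mem; move: b; apply: (gen_ind gen).
- by rewrite -(addNr 1) -scaleN1r; exact: SZ.
- by move=> a b c; exact: SZ.
- elim=> [|i w IH]; first by rewrite ev_nil.
  rewrite -cat1s ev_cat; apply: SM => //.
  by apply/mem_set/sub; exact: deg_le_ev.
Qed.

Let dim n := subspace_dim (deg_le n).

Lemma GKdim1_unbounded : generating x -> has_GKdim B (1%E : \bar R) -> ~ bounded_degree x.
Proof.
move=> gen [_ /(_ _ (frame_deg_le gen)) gk] [n0 bd].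
have dimE n : (n0 <= n)%N -> dim n = dim n0.
  move=> le; rewrite /dim; congr subspace_dim; rewrite eqEsubset; split=> // b _.
  by apply: deg_leW le _ _; exact: bd.
suff : (growth_exponent R (deg_le 1) <= (2^-1 : R)%:E)%E by rewrite gk lee_fin; lra.
apply: (limn_esup_le (n0 := (n0 + dim n0 ^ 2).+2)) => n len.
rewrite lee_fin subspace_pow_deg_le -/(dim n) dimE; last by lia.
have n1 : 1 < n%:R :> R by rewrite ltr1n; lia.
have lnn : 0 < ln (n%:R : R) by apply: ln_gt0.
rewrite ler_pdivrMr //.
have [->|d0] := posnP (dim n0).
  by rewrite ln0 // mulr_ge0 ?invr_ge0 ?ler0n // ltW.
suff : ln ((dim n0)%:R ^+ 2 : R) <= ln n%:R by rewrite lnXn ?ltr0n // mulr2n; lra.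
rewrite ler_ln ?posrE ?exprn_gt0 ?ltr0n //; last by lia.
by rewrite -natrX ler_nat; lia.
Qed.

(** Otherwise the dimension of deg_le n would be at least n ^ 2 / 2 by Bergman's
    gap. The exponent 3 / 2 is enough for a contradiction and absorbs the
    factor 1 / 2 from n = 4 on. *)
Lemma GKdim1_linear : generating x -> has_GKdim B (1%E : \bar R) ->
  exists D, forall n m, rank_ge (deg_le n) m -> (m <= D * n.+1)%N.
Proof.
move=> gen [_ /(_ _ (frame_deg_le gen)) gk]; apply: linear_growth.
apply: contrapT => h; have lt i : (i < count_words (normal_words x) i)%N.
  by rewrite ltnNge; apply/negP => le; apply: h; exists i.
suff : ((3 / 2 : R)%:E <= growth_exponent R (deg_le 1))%E by rewrite gk lee_fin; lra.
apply: (limn_esup_ge (n0 := 4)) => n len.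
rewrite lee_fin subspace_pow_deg_le.
have n1 : 1 < n%:R :> R by rewrite ltr1n; lia.
have lnn : 0 < ln (n%:R : R) by apply: ln_gt0.
rewrite ler_pdivlMr //; have := quadratic_lower_bound n lt; rewrite -/(dim n) => le.
have d0 : (0 < dim n)%N by move: le; case: (dim n) => //; case: (n) len.
suff : ln ((n%:R : R) ^+ 3) <= ln ((dim n)%:R ^+ 2).
  by rewrite !lnXn ?ltr0n //; [rewrite -!(mulr_natl (ln _)); lra|lia].
rewrite ler_ln ?posrE ?exprn_gt0 ?ltr0n //; last by lia.
rewrite -!natrX ler_nat.
have : (4 * n ^ 3 <= n ^ 4)%N by rewrite (expnS n 3) leq_mul2r len orbT.
have : (n ^ 4 <= 4 * dim n ^ 2)%N.
  by rewrite (expnM n 2 2) -(expnMn 2 _ 2) leq_exp2r.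
by lia.
Qed.
End GKdim.

(** * The standard identity *)

Definition standard_poly (B : nzRingType) m (a : 'I_m -> B) : B :=
  \sum_(s : 'S_m) (-1) ^+ s * \prod_(i < m) a (s i).

Lemma standard_poly_repeat (B : nzRingType) m (a : 'I_m -> B) i1 i2 :
  i1 != i2 -> a i1 = a i2 -> standard_poly a = 0.
Proof.
move=> neq eqa; pose t := tperm i1 i2.
have oddMt (s : 'S_m) : (s * t)%g = ~~ s :> bool.
  by rewrite odd_permM odd_tperm neq addbT.
rewrite /standard_poly (bigID (@odd_perm _)) /=.
apply: canLR (subrK _) _; rewrite add0r -sumrN.
rewrite (reindex_inj (mulIg t)); apply: eq_big => [s|s]; first by rewrite oddMt.
rewrite oddMt => /negPf ->; rewrite expr1 expr0 mulN1r mul1r; congr (- _).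
apply: eq_bigr => i _; rewrite permM /t.
by case: tpermP => // ->.
Qed.

(** The standard polynomial is multilinear over the centre and alternating, and
    among m > n basis elements two are equal. *)
Lemma standard_poly_spanned (R : comNzRingType) (E : algType R) n (g : 'I_n -> E)
    m (a : 'I_m -> E) : (n < m)%N ->
  (forall i, exists c : 'I_n -> R, a i = \sum_j c j *: g j) -> standard_poly a = 0.
Proof.
move=> ltnm /choice[C aC].
have expand (s : 'S_m) : \prod_(i < m) a (s i) =
    \sum_(h : {ffun 'I_m -> 'I_n}) (\prod_i C i (h i)) *: \prod_i g (h (s i)).
  under eq_bigr do rewrite aC.
  rewrite bigA_distr_bigA /=.
  rewrite (reindex_inj (h := fun h : {ffun 'I_m -> 'I_n} => [ffun i => h (s i)])) /=.
    apply: eq_bigr => h _; under eq_bigr do rewrite ffunE.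
    rewrite scaler_prod; congr (_ *: _).
    by rewrite [RHS](reindex_inj (@perm_inj _ s)).
  move=> h h' /ffunP e; apply/ffunP => i; have := e (s^-1%g i).
  by rewrite !ffunE permKV.
rewrite /standard_poly.
under eq_bigr do rewrite expand mulr_sumr.
rewrite exchange_big big1 //= => h _.
under eq_bigr do rewrite -scalerAr.
rewrite -scaler_sumr; have [i1 [i2 ne eqh]] : exists i1, exists2 i2, i1 != i2 & h i1 = h i2.
  have /injectivePn[i1 [i2 ne e]] : ~~ injectiveb h.
    by apply/negP => /injectiveP/leq_card; rewrite !card_ord leqNgt ltnm.
  by exists i1, i2.
have /= e0 := standard_poly_repeat (a := g \o h) ne (congr1 g eqh).
by rewrite [X in _ *: X]e0 scaler0.
Qed.

Section PeriodicMatrices.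
Variables (k : fieldType) (d p' : nat) (f : nat -> 'I_d).
Local Notation p := p'.+1.
Hypothesis per : periodic p f.

(** The letter i acts as the arrows labelled i of a cyclic quiver spelling the
    period of f, with the power of 'X recording the length. *)
Definition arrow_mx (i : 'I_d) : 'M[{poly k}]_p :=
  \matrix_(a, b) (((f a == i) && (b == inZp a.+1))%:R * 'X).

Lemma periodic_mod n j : f (n %% p + j)%N = f (n + j)%N.
Proof.
by rewrite -(periodicM (n %/ p) per (n %% p + j)) addnAC [(n %% p + _)%N]addnC -divn_eq.
Qed.

Lemma arrow_mxE (w : seq 'I_d) (a b : 'I_p) : ev arrow_mx w a b =
  ((w == map f (iota a (size w))) && (b == inZp (a + size w)))%:R * 'X^(size w).
Proof.
elim: w a => [|i w IH] a.
  rewrite ev_nil mxE mulr1 /= addn0 eq_sym; congr (nat_of_bool _)%:R.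
  by apply/eqP/eqP => ->; [apply: val_inj; rewrite /= modn_small|
     apply: val_inj; rewrite /= modn_small].
rewrite /ev big_cons -/(ev arrow_mx w) mxE (bigD1 (inZp a.+1)) //= big1 ?addr0; last first.
  by move=> c /negPf nc; rewrite mxE nc andbF !mul0r.
rewrite mxE eqxx andbT IH.
have -> : (w == map f (iota (inZp a.+1 : 'I_p) (size w))) =
    (w == map f (iota a.+1 (size w))).
  by congr (w == _); apply: eq_window => j _; rewrite /= periodic_mod.
have -> : inZp ((inZp a.+1 : 'I_p) + size w) = inZp (a + (size w).+1) :> 'I_p.
  by apply: val_inj; rewrite /= modnDml addSnnS.
rewrite eqseq_cons exprS [i == _]eq_sym.
case: (f a == i); rewrite /= ?mul0r //.
by rewrite mul1r mulrCA.
Qed.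

Variables (B : algType k) (x : 'I_d -> B).
Hypothesis gen : generating x.
Hypothesis sub : forall w, nonzero_words x w -> factors f w.

(** Two evaluations of one linear combination of words, in matrices and in B;
    this relation is a subalgebra of the product of the two algebras. *)
Definition evaluates_to (eb : 'M[{poly k}]_p * B) := exists s : seq (k * seq 'I_d),
  eb.1 = \sum_(y <- s) y.1%:P *: ev arrow_mx y.2 /\
  eb.2 = \sum_(y <- s) y.1 *: ev x y.2.

Lemma evaluates_to1 : evaluates_to (1, 1).
Proof. by exists [:: (1, [::])]; rewrite !big_seq1 /= !ev_nil !scale1r. Qed.

Lemma evaluates_toD e b e' b' : evaluates_to (e, b) -> evaluates_to (e', b') ->
  evaluates_to (e + e', b + b').
Proof. by move=> [s /= [-> ->]] [s' /= [-> ->]]; exists (s ++ s'); rewrite !big_cat. Qed.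

Lemma evaluates_to0 : evaluates_to (0, 0).
Proof. by exists [::]; rewrite !big_nil. Qed.

Lemma evaluates_toM e b e' b' : evaluates_to (e, b) -> evaluates_to (e', b') ->
  evaluates_to (e * e', b * b').
Proof.
move=> [s /= [-> ->]] [s' /= [-> ->]].
exists [seq (y.1 * z.1, y.2 ++ z.2) | y <- s, z <- s']; rewrite !big_allpairs_dep /=; split.
  rewrite mulr_suml; apply: eq_bigr => y _; rewrite mulr_sumr; apply: eq_bigr => z _.
  by rewrite -scalerAl -scalerAr scalerA -polyCM -ev_cat.
rewrite mulr_suml; apply: eq_bigr => y _; rewrite mulr_sumr; apply: eq_bigr => z _.
by rewrite -scalerAl -scalerAr scalerA -ev_cat.
Qed.

Lemma evaluates_toN e b : evaluates_to (e, b) -> evaluates_to (- e, - b).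
Proof.
move=> [s /= [-> ->]]; exists [seq (- y.1, y.2) | y <- s]; rewrite !big_map /=.
by rewrite -!sumrN; split; apply: eq_bigr => y _; rewrite ?polyCN scaleNr.
Qed.

Lemma evaluates_to_surj b : exists e, evaluates_to (e, b).
Proof.
move: b; apply: (gen_ind gen).
- by exists 0; exact: evaluates_to0.
- move=> c b b' [e eb] [e' eb']; exists (c%:P *: e + e').
  apply: evaluates_toD eb'; have [s /= [-> ->]] := eb.
  exists [seq (c * y.1, y.2) | y <- s]; rewrite !big_map !scaler_sumr /=; split.
    by apply: eq_bigr => y _; rewrite scalerA polyCM.
  by apply: eq_bigr => y _; rewrite scalerA.
- move=> w; exists (ev arrow_mx w), [:: (1, w)].
  by rewrite !big_seq1 /= !scale1r.
Qed.

(** Distinct factors of f have matrices with disjoint supports or different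
    powers of 'X, hence are linearly independent. *)
Lemma evaluates_to_inj b : evaluates_to (0, b) -> b = 0.
Proof.
move=> [s /= [e0 ->]]; pose W := undup (map snd s).
have -> : \sum_(y <- s) y.1 *: ev x y.2 =
    \sum_(w <- W) (\sum_(y <- s | y.2 == w) y.1) *: ev x w.
  under [RHS]eq_bigr do rewrite scaler_suml.
  rewrite [RHS](exchange_big_dep xpredT) //= big_seq [RHS]big_seq.
  apply: eq_bigr => y ys; under eq_bigl do rewrite eq_sym.
  by rewrite -big_filter (filter_pred1_uniq (undup_uniq _)) ?big_seq1 // mem_undup map_f.
apply: big1 => w _; have [->|/eqP nw] := eqVneq (ev x w) 0; first by rewrite scaler0.
have [j ew] := sub nw; pose a : 'I_p := inZp j.
have {}ew : w = map f (iota a (size w)).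
  by rewrite {1}ew; apply: eq_window => i _; rewrite /= periodic_mod.
have := congr1 (fun M : 'M[{poly k}]_p => (M a (inZp (a + size w)))`_(size w)) e0.
rewrite /= mxE coef0 summxE coef_sum => h.
suff -> : \sum_(y <- s | y.2 == w) y.1 = 0 by rewrite scale0r.
rewrite [RHS]h big_mkcond /=; apply: eq_bigr => y _.
rewrite mxE arrow_mxE coefCM mulr_natl coefMn coefXn.
have [->|ne] := eqVneq y.2 w.
  by rewrite {1}ew !size_map !size_iota !eqxx -ew eqxx mulr1.
have [e|_] := eqVneq (size w) (size y.2); last by rewrite mul0rn mulr0.
have -> : (y.2 == map f (iota a (size y.2))) = false.
  by apply/negbTE; rewrite -e -ew.
by rewrite mulr0n mulr0.
Qed.

(** B is a quotient of a subalgebra of the p by p matrices over {poly k}, which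
    are spanned by p * p elements over a central subring. *)
Lemma periodic_standard_identity m : (p * p < m)%N -> satisfies_standard_identity B m.
Proof.
move=> ltm b; have /choice[e eb] := fun i => evaluates_to_surj (b i).
apply: evaluates_to_inj.
have <- : standard_poly e = 0.
  apply: (standard_poly_spanned (n := #|{: 'I_p * 'I_p}|)
     (g := fun r => delta_mx (enum_val r).1 (enum_val r).2)).
    by rewrite card_prod !card_ord.
  move=> i; exists (fun r => e i (enum_val r).1 (enum_val r).2).
  rewrite {1}[e i]matrix_sum_delta pair_bigA /=.
  rewrite (reindex (@enum_val _ {: 'I_p * 'I_p})) //=.
  by exists enum_rank => r _; rewrite ?enum_rankK ?enum_valK.
rewrite /standard_poly.
pose G := evaluates_to.
apply: (big_rec2 (fun b e => G (e, b))) => [|s b1 e1 _ IH]; first exact: evaluates_to0.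
apply: evaluates_toD IH; apply: evaluates_toM.
  case: (odd_perm s); last exact: evaluates_to1.
  by rewrite expr1; apply: evaluates_toN; exact: evaluates_to1.
apply: (big_rec2 (fun b e => G (e, b))) => [|i b2 e2 _]; first exact: evaluates_to1.
exact: evaluates_toM.
Qed.
End PeriodicMatrices.

Lemma scalar_standard_identity (k : fieldType) (B : algType k) d (x : 'I_d -> B) m :
  generating x -> (forall w, nonzero_words x w -> w = [::]) -> (1 < m)%N ->
  satisfies_standard_identity B m.
Proof.
move=> gen tr lt1m b.
apply: (standard_poly_spanned (n := 1) (g := fun=> 1) lt1m) => i.
suff [c ->] : exists c : k, b i = c *: 1 by exists (fun=> c); rewrite big_ord1.
move: (b i); apply: (gen_ind gen).
- by exists 0; rewrite scale0r.
- by move=> a _ _ [c ->] [c' ->]; exists (a * c + c'); rewrite scalerDl scalerA.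
- move=> w; have [->|/eqP/tr ->] := eqVneq (ev x w) 0; first by exists 0; rewrite scale0r.
  by exists 1; rewrite scale1r ev_nil.
Qed.

(** * Monomial algebras *)

Section FreeAlgebra.
Variables (k : fieldType) (d : nat).
Local Notation F := (freeAlg k d).

Lemma wordM (v w : fmonom 'I_d) : word k v * word k w = word k (FMonom (v ++ w)) :> F.
Proof.
rewrite /word -fmE; change (fgmul (mkmalgU v 1) (mkmalgU w 1) = mkmalgU (mmul v w) 1 :> malg _ k).
by rewrite fgmulUU mulr1.
Qed.

Lemma word1 : word k (FMonom [::]) = 1 :> F.
Proof. by rewrite /word -fmE. Qed.

Lemma freeAlg_sum (a : F) : a = \sum_(m <- msupp a) mcoeff m a *: word k m.
Proof.
rewrite {1}[a]monalgE; apply: eq_bigr => m _; apply/malgP => m'.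
by rewrite mcoeffZ /word !mcoeffU mulr_natr.
Qed.

Section Presentation.
Variables (B : algType k) (g : {lrmorphism F -> B}).

Definition letters (i : 'I_d) : B := g (word k (FMonom [:: i])).

Lemma ev_letters w : ev letters w = g (word k (FMonom w)).
Proof.
elim: w => [|i w IH]; first by rewrite ev_nil word1 rmorph1.
by rewrite -cat1s ev_cat IH /ev big_seq1 -rmorphM /= wordM.
Qed.

Lemma letters_sum a : g a = \sum_(m <- msupp a) mcoeff m a *: ev letters m.
Proof.
rewrite {1}[a]freeAlg_sum linear_sum; apply: eq_bigr => m _.
by rewrite linearZ ev_letters; case: m.
Qed.

Lemma letters_generating : (forall b, exists a, g a = b) -> generating letters.
Proof.
move=> surj b; have [a <-] := surj b; rewrite letters_sum big_seq.
exists (\max_(m <- msupp a) size m); apply: lspan_sum => m ma.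
by apply: lspanZ; apply: deg_le_ev; exact: leq_bigmax_seq.
Qed.
End Presentation.

Variable I : properIdeal F.
Local Notation A := (quotAlg I).
Hypothesis monI : monomial_ideal I.
Local Notation X := (letters (proj I)).

(** The elements all of whose words lie in I form an ideal that contains the
    generating words. *)
Lemma monomial_ideal_support a m : ideal_set I a -> mcoeff m a != 0 ->
  ideal_set I (word k m).
Proof.
have [W IW] := monI; have [_ IM] := ideal_setP I.
pose J : set F := [set a | forall m, mcoeff m a != 0 -> ideal_set I (word k m)].
suff : ideal_set I `<=` J by move=> sub /sub; exact.
have Iw w : W w -> ideal_set I (word k w).
  by move=> Ww; rewrite IW; apply: sub_gen_smallest; exists w.
rewrite IW; apply: smallest_sub; last first.
  move=> _ [w Ww <-] m'; rewrite /word mcoeffU.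
  by have [<- _|_] := eqVneq w m'; [exact: Iw|rewrite eqxx].
split; first split.
- by apply/mem_set => m'; rewrite mcoeff0 eqxx.
- move=> u v /set_mem Ju /set_mem Jv; apply/mem_set => m'; rewrite mcoeffB => nz.
  have [u0|/Ju//] := eqVneq (mcoeff m' u) 0.
  by apply: Jv; move: nz; rewrite u0 sub0r oppr_eq0.
- move=> c u Ju; split=> m'; rewrite mcoeff_neq0 => /msuppM_le[m1 [m2 [h1 h2 ->]]].
    have -> : word k (mmul m1 m2) = word k m1 * word k m2 by rewrite wordM -fmE.
    by apply: (IM _ _ _).1; apply: Ju; rewrite mcoeff_neq0.
  have -> : word k (mmul m1 m2) = word k m1 * word k m2 by rewrite wordM -fmE.
  by apply: (IM _ _ _).2; apply: Ju; rewrite mcoeff_neq0.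
Qed.

Lemma monomial_words_indep (s : seq (seq 'I_d)) : uniq s ->
  {in s, forall w, nonzero_words X w} ->
  lin_indep (fun i : 'I_(size s) => ev X (nth [::] s i)).
Proof.
move=> us nz c c0 i.
have : ideal_set I (\sum_(j < size s) c j *: word k (FMonom (nth [::] s j))).
  rewrite -[X in ideal_set I X]subr0; apply/proj_eq; rewrite linear0 linear_sum -[RHS]c0.
  by apply: eq_bigr => j _; rewrite linearZ ev_letters.
move=> h; apply/eqP; apply: contraT => ci.
have := nz _ (mem_nth [::] (ltn_ord i)); case.
rewrite ev_letters -[RHS](linear0 (proj I)); apply/proj_eq; rewrite subr0.
apply: (monomial_ideal_support h); rewrite raddf_sum (bigD1 i) //= big1 ?addr0.
  by rewrite mcoeffZ /word mcoeffUU mulr1.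
move=> j ji; rewrite mcoeffZ /word mcoeffU; case: eqP => [[e]|_]; last by rewrite mulr0n mulr0.
by move/eqP: e; rewrite nth_uniq // (inj_eq val_inj) (negPf ji).
Qed.
End FreeAlgebra.

Section SubspacePowers.
Variables (k : fieldType) (A : algType k) (V : set A).
Hypothesis V1 : V 1.
Local Notation pow := (subspace_pow V).

Lemma subspace_pow_closed n : GRing.submod_closed [in pow n].
Proof. by case: n => [|n]; exact: lspan_closed. Qed.

Lemma subspace_powW m n : (m <= n)%N -> pow m `<=` pow n.
Proof.
move=> /subnK <-; elim: (n - m)%N => // l IH a /IH la.
by apply: sub_lspan; exists 1 => //; exists a => //; rewrite mul1r.
Qed.

Lemma subspace_pow1 n : pow n 1.
Proof. by apply: (subspace_powW (leq0n n)); exact: sub_lspan. Qed.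

Lemma subspace_powM m n a b : pow m a -> pow n b -> pow (m + n) (a * b).
Proof.
have powDZ l c u v : pow l u -> pow l v -> pow l (c *: u + v).
  by case: l => [|l]; exact: lspanDZ.
have pow0 l : pow l 0 by case: l => [|l]; exact: lspan0.
elim: m a => [|m IH] a /=.
  move=> + nb; move: a; apply: lspan_ind.
  - by rewrite mul0r.
  - by move=> c u v ? ?; rewrite mulrDl -scalerAl; exact: powDZ.
  - by move=> _ ->; rewrite mul1r.
move=> + nb; move: a; apply: (lspan_ind (P := fun a => pow (m.+1 + n) (a * b))).
- by rewrite mul0r.
- by move=> c u v ? ?; rewrite mulrDl -scalerAl; exact: powDZ.
- move=> _ [u Vu [v mv <-]]; rewrite -mulrA; apply: sub_lspan.
  by exists u => //; exists (v * b) => //; exact: IH.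
Qed.

Lemma generates_pow : generates V -> forall a, exists n, pow n a.
Proof.
move=> gV a; have : [set: A] a by [].
rewrite -gV => /(_ [set a | exists n, pow n a]); apply; split; last first.
  move=> u Vu; exists 1%N; apply: sub_lspan; exists u => //; exists 1; rewrite ?mulr1 //.
  exact: sub_lspan.
split=> [|c u v|u v].
- by apply/mem_set; exists 0%N; exact: subspace_pow1.
- move=> /set_mem[m mu] /set_mem[n nv]; apply/mem_set; exists (maxn m n).
  have [_ cl] := subspace_pow_closed (maxn m n); apply/set_mem/cl; apply/mem_set.
    exact: subspace_powW (leq_maxl m n) _ mu.
  exact: subspace_powW (leq_maxr m n) _ nv.
- move=> /set_mem[m mu] /set_mem[n nv]; apply/mem_set; exists (m + n)%N.
  exact: subspace_powM.
Qed.
End SubspacePowers.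

(** In a monomial algebra the nonzero words are linearly independent, and those
    of length at most n lie in the power M n of the frame, where M is such that
    the power M contains the letters. *)
Lemma monomial_quadratic_words (R : realType) (k : fieldType) (d : nat)
    (I : properIdeal (freeAlg k d)) : monomial_ideal I ->
  quadratic_growth (quotAlg I) R ->
  exists C, quadratic_words (nonzero_words (letters (proj I))) C.
Proof.
move=> monI [V [[_ _ V1 gV] [C1 [C2 [C10 C20 gr]]]]].
set x := letters (proj I).
have /choice[m mP] : forall i, exists m, subspace_pow V m (x i).
  by move=> i; exact: generates_pow.
pose M := (\max_i m i).+1.
have xM i : subspace_pow V M (x i).
  by apply: subspace_powW (mP i) => //; apply: leqW; exact: (leq_bigmax (F := m)).
have evM w : subspace_pow V (M * size w) (ev x w).
  elim: w => [|i w IH]; first by rewrite ev_nil muln0; exact: sub_lspan.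
  have -> : (M * size (i :: w) = M + M * size w)%N by rewrite mulnS.
  by rewrite /ev big_cons -/(ev x w); exact: (subspace_powM (xM i) IH).
have [C CP] : exists C : nat, C2 * M%:R ^+ 2 <= C%:R.
  exists (Num.bound (C2 * M%:R ^+ 2)); apply/ltW/archi_boundP.
  by rewrite mulr_ge0 ?exprn_ge0 ?ler0n // ltW.
exists C => n s n0 us sP.
have Mn0 : (0 < M * n)%N by rewrite muln_gt0.
have [lo up] := andP (gr _ Mn0).
(* the lower bound excludes the junk value of subspace_dim *)
have dim0 : (0 < subspace_dim (subspace_pow V (M * n)))%N.
  rewrite -(ltr_nat R); apply: lt_le_trans lo.
  by rewrite mulr_gt0 // exprn_gt0 // ltr0n.
have le : (size s <= subspace_dim (subspace_pow V (M * n)))%N.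
  apply: (has_dim_leq (subspace_dim_gt0 dim0)).
  exists (fun i => ev x (nth [::] s i)); split.
    by apply: monomial_words_indep => // w /sP[].
  move=> i; have [_ lew] := sP _ (mem_nth [::] (ltn_ord i)).
  by apply: subspace_powW (evM _) => //; rewrite leq_mul2l lew orbT.
move: le; rewrite -!(ler_nat R) => le; apply: le_trans le _.
apply: le_trans up _; rewrite [(M * n)%:R]natrM exprMn mulrA [leRHS]natrM natrX.
by rewrite ler_wpM2r // exprn_ge0 // ler0n.
Qed.

(** * Prime images of a monomial algebra *)

Definition periodic_sublanguages (X : finType) (L : set (seq X)) : set (set (seq X)) :=
  [set Z | (exists p f, periodic p f /\ Z = factors f) /\ Z `<=` L].

Lemma periodic_sublanguages_finite (X : finType) (L : set (seq X)) C :
  prime_language L -> quadratic_words L C -> finite_set (periodic_sublanguages L).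
Proof.
move=> prL qL; apply: contrapT => /(infinite_set_fset (9 * C).+2)[S sub leS].
have SP (i : 'I_#|` S|) : periodic_sublanguages L (nth set0 S i).
  by apply: sub; rewrite /= mem_nth.
have := card_periodic_sublanguages (Z := fun i : 'I_#|` S| => nth set0 S i) prL qL.
move=> h; suff : (#|` S| <= (9 * C).+1)%N by rewrite leqNgt leS.
apply: h.
- by move=> i j /eqP; rewrite nth_uniq ?fset_uniq // => /eqP/val_inj.
- by move=> i; case: (SP i).
- by move=> i; case: (SP i).
Qed.

Lemma proj_eq0 (k : fieldType) (A : algType k) (I : properIdeal A) (a : A) :
  proj I a = 0 <-> ideal_set I a.
Proof.
have e0 : proj I 0 = 0 by exact: raddf0.
have := proj_eq I a 0; rewrite e0 subr0; exact.
Qed.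

Section Quotients.
Variables (k : fieldType) (d : nat) (I : properIdeal (freeAlg k d)).
Local Notation A := (quotAlg I).
Local Notation x := (letters (proj I)).
Variable C : nat.
Hypothesis prA : prime_algebra A.
Hypothesis qL : quadratic_words (nonzero_words x) C.

Section Image.
Variables (B : algType k) (g : {lrmorphism A -> B}).
Hypothesis surj : forall b, exists a, g a = b.

Definition image_letters i := g (x i).

Lemma ev_image w : ev image_letters w = g (ev x w).
Proof. by rewrite /ev rmorph_prod. Qed.

Lemma image_nonzero_words : nonzero_words image_letters `<=` nonzero_words x.
Proof. by move=> w; rewrite /nonzero_words /= ev_image => h e; apply: h; rewrite e rmorph0. Qed.

Lemma image_quadratic_words : quadratic_words (nonzero_words image_letters) C.
Proof.
move=> n s n0 us sP; apply: qL => // w /sP[nw lew]; split=> //.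
exact: image_nonzero_words.
Qed.

Lemma image_sum (a : freeAlg k d) :
  g (proj I a) = \sum_(m <- msupp a) mcoeff m a *: ev image_letters m.
Proof.
rewrite letters_sum linear_sum; apply: eq_bigr => m _.
by rewrite linearZ ev_image.
Qed.

Lemma image_generating : generating image_letters.
Proof.
move=> b; have [a <-] := surj b; have [f <-] := proj_surj a.
rewrite image_sum big_seq.
exists (\max_(m <- msupp f) size m); apply: lspan_sum => m ma.
by apply: lspanZ; apply: deg_le_ev; exact: leq_bigmax_seq.
Qed.

Hypothesis prB : prime_ring B.

(** The trivial case is that of an image of dimension one. *)
Lemma image_language : (exists u, good_word image_letters u) ->
  (forall w, nonzero_words image_letters w -> w = [::]) \/
  exists p f, periodic p f /\ nonzero_words image_letters = factors f.
Proof.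
move=> [u gu].
have [|] := good_word_periodic image_generating prB gu image_quadratic_words.
  by move=> h; left.
by right.
Qed.

(** All the words of an element of the kernel vanish: otherwise those that do
    not would satisfy a nontrivial relation, which bounds the degree. *)
Lemma image_monomial_relation p (f : nat -> 'I_d) (a : freeAlg k d) :
  ~ bounded_degree image_letters -> periodic p f ->
  nonzero_words image_letters = factors f -> g (proj I a) = 0 ->
  forall m, m \in msupp a -> ev image_letters m = 0.
Proof.
move=> unb pf eL; rewrite image_sum => a0 m0 m0a.
apply: contrapT => nz; apply: unb.
pose s := [seq m <- enum_fset (msupp a) |
  `[< nonzero_words image_letters (fmonom_val m) >]].
apply: (periodic_relation (s := map (@fmonom_val _) s)
  (c := fun w => mcoeff (FMonom w) a) image_generating pf eL).
- by move=> w /mapP[m]; rewrite mem_filter => /andP[/asboolP nm _] ->.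
- rewrite big_map big_filter -[RHS]a0 big_mkcond; apply: eq_bigr => -[w] _ /=.
  by case: asboolP => // /contrapT ->; rewrite scaler0.
- by rewrite map_inj_uniq ?filter_uniq ?fset_uniq //; exact: val_inj.
- apply/hasP; exists (fmonom_val m0).
    by rewrite map_f // mem_filter m0a andbT; exact/asboolP.
  by case: m0 m0a {nz} => w; rewrite mcoeff_neq0.
Qed.
End Image.

Lemma prime_quotient_ring (P : properIdeal A) : prime_ideal P -> prime_ring (quotAlg P).
Proof.
move=> prP u v; have [a <-] := proj_surj u; have [b <-] := proj_surj v => uv.
have [|Pa|Pb] := prime_ideal_elementwise prP (a := a) (b := b).
- by move=> c; apply/proj_eq0; rewrite !rmorphM; exact: uv.
- by left; apply/proj_eq0.
- by right; apply/proj_eq0.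
Qed.

Variable R : realType.

Lemma GKdim1_language (P : properIdeal A) : prime_ideal P ->
  has_GKdim (quotAlg P) (1%E : \bar R) ->
  ~ bounded_degree (image_letters (proj P)) /\
  exists p f, periodic p f /\ nonzero_words (image_letters (proj P)) = factors f.
Proof.
move=> prP gk; have gen := image_generating (@proj_surj _ _ P).
have unb := GKdim1_unbounded gen gk; split=> //.
have [D lin] := GKdim1_linear gen gk.
have prB := prime_quotient_ring prP.
have [tr|//] := image_language (@proj_surj _ _ P) prB (good_word_linear gen prB unb lin).
case: unb; exists 0%N; apply: (gen_ind gen).
- exact: lspan0.
- by move=> a b c; exact: lspanDZ.
- move=> w; have [->|/eqP/tr ->] := eqVneq (ev (image_letters (proj P)) w) 0.
    exact: lspan0.
  exact: deg_le_ev.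
Qed.

Lemma GKdim1_monomial (P : properIdeal A) : prime_ideal P ->
  has_GKdim (quotAlg P) (1%E : \bar R) ->
  ideal_set P = ideal_gen [set proj I (word k (FMonom w)) |
    w in [set w | ~ nonzero_words (image_letters (proj P)) w]].
Proof.
move=> prP gk; have [unb [p [f [pf eL]]]] := GKdim1_language prP gk.
set S := [set proj I _ | _ in _].
rewrite eqEsubset; split; last first.
  apply: smallest_sub; first exact: ideal_setP.
  move=> _ [w /contrapT h <-]; rewrite -ev_letters.
  by apply/proj_eq0; rewrite -ev_image.
have [idZ idM] : two_sided_ideal (ideal_gen S).
  split; first split.
  - by apply/mem_set => J [[[J0 _] _] _]; exact/set_mem.
  - move=> u v /set_mem Su /set_mem Sv; apply/mem_set => J [tJ SJ].
    by have [[_ JB] _] := tJ; apply/set_mem/JB; apply/mem_set; [exact: Su|exact: Sv].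
  - by move=> c u Su; split=> J [tJ SJ]; have [_ JM] := tJ;
      [apply: (JM _ _ _).1|apply: (JM _ _ _).2]; exact: Su.
move=> a; have [b <-] := proj_surj a => Pb.
have zero := image_monomial_relation (@proj_surj _ _ P) unb pf eL ((proj_eq0 _ _).2 Pb).
rewrite letters_sum big_seq.
have idD u v : ideal_gen S u -> ideal_gen S v -> ideal_gen S (u + v).
  move=> /mem_set Su /mem_set Sv; apply/set_mem; rewrite -[v]opprK.
  by apply: idZ.2 => //; rewrite -[- v]sub0r; apply: idZ.2 => //; exact: idZ.1.
elim/big_ind: _ => //; first exact/set_mem/idZ.1.
move=> m mb; rewrite -mulr_algl; apply: (idM _ _ _).1; apply: sub_gen_smallest.
exists (fmonom_val m); last by rewrite ev_letters.
by case; exact: zero mb.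
Qed.

Lemma properIdeal_eq (P Q : properIdeal A) : ideal_set P = ideal_set Q -> P = Q.
Proof.
case: P Q => P tP P1 [Q tQ Q1] /= e; rewrite -e in tQ Q1 *.
by congr Defs.ProperIdeal; exact: Prop_irrelevance.
Qed.

Let prL : prime_language (nonzero_words x).
Proof.
apply: nonzero_words_prime; last exact: prime_algebra_ring.
by apply: letters_generating => a; exact: proj_surj.
Qed.

(** Being generated by words, P is determined by the words that survive modulo
    P, and these form a periodic sublanguage of the language of A. *)
Lemma GKdim1_finite : finite_set [set P : properIdeal A |
  prime_ideal P /\ has_GKdim (quotAlg P) (1%E : \bar R)].
Proof.
set S := [set P | _]; pose h (P : properIdeal A) := nonzero_words (image_letters (proj P)).
have injh : {in S &, injective h}.
  move=> P Q /set_mem[prP gkP] /set_mem[prQ gkQ] e; apply: properIdeal_eq.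
  by rewrite (GKdim1_monomial prP gkP) (GKdim1_monomial prQ gkQ) -/(h P) -/(h Q) e.
rewrite -(eq_finite_set (inj_card_eq injh)).
apply: sub_finite_set (periodic_sublanguages_finite prL qL) => _ [P [prP gkP] <-].
split; first by have [] := GKdim1_language prP gkP.
exact: image_nonzero_words.
Qed.

Lemma finite_dim_bounded_degree (B : algType k) (y : 'I_d -> B) :
  generating y -> finite_dim [set: B] -> bounded_degree y.
Proof.
move=> gen [m [b [_ sp]]].
have /choice[n nP] : forall i, exists n, deg_le y n (b i) by move=> i; exact: gen.
exists (\max_i n i)%N => c; have : [set: B] c by [].
rewrite -sp; apply: (lspan_le _) => _ [i _ <-].
by apply: deg_leW (nP i); exact: (leq_bigmax (F := n)).
Qed.

(** Every finite-dimensional prime image has a trivial language or one of the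
    finitely many periodic sublanguages, so their periods bound its degree. *)
Lemma bounded_images : bounded_matrix_images A.
Proof.
have /choice[p pP] : forall Z : set (seq 'I_d), exists p : nat,
    periodic_sublanguages (nonzero_words x) Z -> exists f, periodic p f /\ Z = factors f.
  move=> Z; have [[[p [f h]] _]|nZ] := pselect (periodic_sublanguages (nonzero_words x) Z).
    by exists p => _; exists f.
  by exists 0%N.
have /finite_seqP[s sE] := finite_image p (periodic_sublanguages_finite prL qL).
pose M := (\max_(q <- s) q)%N; exists (M * M).+1; split=> // B g rg prB fdB.
have surj b : exists a, g a = b.
  by have : [set: B] b by []; rewrite -rg => -[a _ <-]; exists a.
have gen := image_generating surj; have prB' := prime_algebra_ring prB.
have bd := finite_dim_bounded_degree gen fdB.
have [tr|[q [f0 [pf0 eL0]]]] := image_language surj prB' (good_word_bounded gen bd).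
  by apply: (scalar_standard_identity gen tr); lia.
have perZ : periodic_sublanguages (nonzero_words x) (nonzero_words (image_letters g)).
  by split; [exists q, f0|exact: image_nonzero_words].
have [f [pf eL]] := pP _ perZ.
set r := p _ in pf; have rs : r \in s.
  have : [set` s] r by rewrite -sE; exists (nonzero_words (image_letters g)).
  by [].
have ler : (r <= M)%N by exact: (leq_bigmax_seq (F := id)).
case: r pf rs ler => [|r] pf rs ler; first by case: pf.
apply: (periodic_standard_identity (p' := r) (f := f) pf gen).
  by move=> w; rewrite eL.
by have := leq_mul ler ler; lia.
Qed.
End Quotients.

Theorem theorem1p1 (R : realType) (k : fieldType) (d : nat)
    (I : properIdeal (freeAlg k d)) :
  monomial_ideal I ->
  prime_algebra (quotAlg I) ->
  quadratic_growth (quotAlg I) R ->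
  [/\ finite_set [set P : properIdeal (quotAlg I) |
        prime_ideal P /\ has_GKdim (quotAlg P) (1%E : \bar R)],
      forall P : properIdeal (quotAlg I),
        prime_ideal P -> has_GKdim (quotAlg P) (1%E : \bar R) ->
        quot_monomial_ideal P &
      bounded_matrix_images (quotAlg I)].
Proof.
move=> monI prA qA; have [C qL] := monomial_quadratic_words monI qA; split.
- exact: GKdim1_finite prA qL R.
- move=> P prP gk; exists [set m | ~ nonzero_words (image_letters (proj P)) m].
  rewrite (GKdim1_monomial qL prP gk); congr ideal_gen.
  rewrite eqEsubset; split=> _ [w nw <-]; first by exists (FMonom w).
  by exists (fmonom_val w) => //; case: w {nw}.
- exact: bounded_images prA qL.
Qed.
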